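(* For $n\ge 7$: (i) $n=7$: $\mathrm{ex}^{(2)}_3(7;P)=15$ and $\mathrm{Ex}^{(2)}_3(7;P)=\{S^3_7\}$; (ii) $8\le n\le 12$: $\mathrm{ex}^{(2)}_3(n;P)=20+\binom{n-6}{3}$ and $\mathrm{Ex}^{(2)}_3(n;P)=\{K^3_6\cup K^3_{n-6}\}$; (iii) $n=13$: $\mathrm{ex}^{(2)}_3(13;P)=40$ and $\mathrm{Ex}^{(2)}_3(13;P)=\{K^3_6\cup K^3_6\cup K^3_1,\ \mathrm{Co}(13)\}$; (iv) $n\ge 14$: $\mathrm{ex}^{(2)}_3(n;P)=4+\binom{n-4}{2}$ and $\mathrm{Ex}^{(2)}_3(n;P)=\{\mathrm{Co}(n)\}$. (Families are up to isomorphism.)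
   Context: All hypergraphs are 3-uniform (3-graphs); a 3-graph $H$ contains $F$ (written $F\subseteq H$) if $H$ has a sub-3-graph isomorphic to $F$; $H$ is $F$-free otherwise, and $\mathcal F$-free if it is $F$-free for all $F\in\mathcal F$. $P$ is the loose 3-uniform path of length 3: vertices $a,b,c,d,e,f,g$, edges $\{a,b,c\},\{c,d,e\},\{e,f,g\}$. $K^3_m$ is the complete 3-graph on $m$ vertices; $K^3_1$ is an isolated vertex; $F_1\cup F_2$ denotes the vertex-disjoint union. $S^3_n$ is the full star: $n$ vertices, one vertex (center) and all $\binom{n-1}{2}$ triples containing it. The comet $\mathrm{Co}(n)$ ($n\ge 4$) is the $n$-vertex 3-graph consisting of a copy of $K^3_4$ together with all triples containing a fixed vertex $c$ of that $K^3_4$ (the center); i.e. a star with center $c$ on all $n$ vertices restricted to triples meeting... precisely: vertex set $\{c,h_1,h_2,h_3\}\cup R$ with $|R|=n-4$, edges: all triples containing $c$ and two vertices of $R\cup\{c\}$-complement within $R$ (i.e. $\{c,u,v\}$, $u,v\in R$), together with the four triples of $\{c,h_1,h_2,h_3\}$; it has $4+\binom{n-4}{2}$ edges. Turán numbers of higher order: $\mathrm{ex}^{(1)}_3(n;\mathcal F)=\mathrm{ex}_3(n;\mathcal F)$ is the maximum number of edges of an $n$-vertex $\mathcal F$-free 3-graph, and $\mathrm{Ex}^{(1)}_3(n;\mathcal F)$ is the family of $n$-vertex $\mathcal F$-free 3-graphs attaining it. For $s\ge1$, $\mathrm{ex}^{(s+1)}_3(n;\mathcal F)$ is the maximum number of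 edges of an $n$-vertex $\mathcal F$-free 3-graph $H$ such that $H$ is not contained in (i.e. not a sub-3-graph of any copy, on the same vertex set, of) any member of $\mathrm{Ex}^{(1)}_3(n;\mathcal F)\cup\dots\cup\mathrm{Ex}^{(s)}_3(n;\mathcal F)$; $\mathrm{Ex}^{(s+1)}_3(n;\mathcal F)$ is the family of such $H$ attaining this maximum. (For reference, $\mathrm{Ex}^{(1)}_3(7;P)=\{K^3_6\cup K^3_1\}$ and $\mathrm{Ex}^{(1)}_3(n;P)=\{S^3_n\}$ for $n\ge 8$.) *)

(* Defs.v *)
From mathcomp Require Import all_boot fingroup perm.
Set Implicit Arguments. Unset Strict Implicit. Unset Printing Implicit Defensive.

Notation hgraph n := {set {set 'I_n}}.

Definition uniform3 n (H : hgraph n) : bool := [forall e in H, #|e| == 3].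

Definition contains k n (F : hgraph k) (H : hgraph n) : bool :=
  [exists f : {ffun 'I_k -> 'I_n}, injectiveb f && [forall e in F, (f @: e) \in H]].

Definition Ppath : hgraph 7 :=
  [set [set (inord 0 : 'I_7); inord 1; inord 2];
       [set (inord 2 : 'I_7); inord 3; inord 4];
       [set (inord 4 : 'I_7); inord 5; inord 6]].

Definition adm k (F : hgraph k) n (C : {set hgraph n}) : {set hgraph n} :=
  [set H : hgraph n | [&& uniform3 H, ~~ contains F H & ~~ [exists G in C, H \subset G]]].

Definition maxsize n (A : {set hgraph n}) : nat := \max_(H in A) #|H|.

Definition extremal n (A : {set hgraph n}) : {set hgraph n} :=
  [set H in A | #|H| == maxsize A].

Fixpoint Ex_upto k (F : hgraph k) n (s : nat) : {set hgraph n} :=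
  match s with
  | 0 => set0
  | s'.+1 => Ex_upto F n s' :|: extremal (adm F (Ex_upto F n s'))
  end.

(* ex^(s)_3(n;F) and Ex^(s)_3(n;F), for s >= 1 *)
Definition ex k (F : hgraph k) n (s : nat) : nat := maxsize (adm F (Ex_upto F n s.-1)).
Definition Ex k (F : hgraph k) n (s : nat) : {set hgraph n} :=
  extremal (adm F (Ex_upto F n s.-1)).

Definition iso n (H G : hgraph n) : Prop :=
  exists s : {perm 'I_n}, G = [set [set s x | x in e] | e : {set 'I_n} in H].

Definition star n : hgraph n :=
  [set e : {set 'I_n} | (#|e| == 3) && [exists x in e, val x == 0]].

Definition K6_Krest n : hgraph n :=
  [set e : {set 'I_n} | (#|e| == 3) &&
     ([forall x in e, val x < 6] || [forall x in e, 6 <= val x])].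

Definition K6_K6 n : hgraph n :=
  [set e : {set 'I_n} | (#|e| == 3) &&
     ([forall x in e, val x < 6] || [forall x in e, (6 <= val x) && (val x < 12)])].

Definition comet n : hgraph n :=
  [set e : {set 'I_n} | (#|e| == 3) &&
     ([forall x in e, val x < 4] ||
      ([exists x in e, val x == 0] && [forall x in e, (val x == 0) || (4 <= val x)]))].

(* Main.v *)
Require Import Defs.
From mathcomp Require Import all_boot fingroup perm.
From mathcomp Require Import zify.
Set Implicit Arguments. Unset Strict Implicit. Unset Printing Implicit Defensive.

(* A triple system is P-free iff no edge meets each of two disjoint edges in exactly one vertex.
   The stability statement "a P-free H on m vertices is a star, or has fewer than ex^(2) edges, or
   is one of the extremal systems" is proved by strong induction on m; it yields ex^(1) as well.
   - If H is intersecting and not a star, it has at most max(19, 3m - 8) edges (14 for m = 7).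
   - If H is disconnected, its two parts are bounded by induction.
   - Otherwise H contains abc, abd and D with d in D and D disjoint from abc. An edge with exactly
     one of a, b then lies in abcD, which leaves very few of them.
     If D and the page d can be chosen so that a second edge D' has D & D' = {d}, then apart from
     the few edges meeting ab either everything passes through d, so that H lies in a comet, or H
     minus {a, b} is bounded by induction. If not, every edge E that avoids a, b and contains a
     page meets no edge avoiding a, b in exactly one vertex, so E has linearly many neighbours,
     and the edges disjoint from E are bounded by induction. *)

(** The induction needs all three alternatives of [classified]. Deleting vertices may leave a full
    star, which exceeds ex^(2), so a bound on the number of edges alone would not be inherited; and
    a star left over in the forked case is precisely what produces the comet. The extremal systems
    must be known exactly because the growth of ex^(2) is sometimes no larger than what is removed:
    from 8 to 10 vertices it grows by 4, which is also the number of edges that removing a and b may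
    cost, and from 12 to 13 vertices it does not grow at all. Seven vertices are special: there K6
    beats the star, and a fork cannot occur, since it spans at least eight vertices. In the unforked
    case the first Turan number suffices as the inductive bound: the edges disjoint from E live on
    at most m - 6 vertices, and the drop in the number of available edges outweighs the linear
    number of neighbours of E. *)

Ltac split_mem := repeat match goal with
  | H : is_true (_ || _) |- _ => case/orP: H => H
  | H : is_true (_ && _) |- _ => let K := fresh "K" in case/andP: H => H K
  | H : is_true (~~ (_ || _)) |- _ => rewrite negb_or in H
  | H : is_true (in_mem _ (mem ?A)) |- _ =>
      lazymatch A with
      | context [@setU] => rewrite in_setU in H
      | context [@setI] => rewrite in_setI in H
      | context [@setD] => rewrite in_setD in H
      | context [@set1] => rewrite in_set1 in H
      end
  | H : is_true (~~ in_mem _ (mem ?A)) |- _ =>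
      lazymatch A with
      | context [@setU] => rewrite in_setU in H
      | context [@set1] => rewrite in_set1 in H
      end
  | H : is_true (?x == ?x) |- _ => clear H
  | H : is_true (?x == ?y) |- _ => move/eqP: H => H; try subst x; try subst y
  end.

Ltac mem_done := match goal with
  | H : is_true (?x != ?x) |- _ => by rewrite eqxx in H
  | H : is_true (~~ ?b), H' : is_true ?b |- _ => by rewrite H' in H
  | |- is_true (in_mem _ _) =>
      rewrite ?inE ?eqxx ?orbT //;
      repeat first [done | apply/orP; left; done | apply/orP; right]
  | |- _ => done
  end.

Ltac mem_solve := intros; split_mem; mem_done.

(** A test run only for success or failure; it leaves the goal alone. The cast to [nat] rejects, for
    instance, equations between sets. *)
Ltac arith P := lazymatch P with
  | @eq _ ?x _ => let y := constr:(x : nat) in idtac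
  | is_true (leq _ _) => idtac
  | is_true (@eq_op _ ?x _) => let y := constr:(x : nat) in idtac
  | is_true (negb ?b) => arith (is_true b)
  | is_true (andb ?b ?c) => arith (is_true b); arith (is_true c)
  | is_true (orb ?b ?c) => arith (is_true b); arith (is_true c)
  | ?A -> ?B => arith A; arith B
  | ?A /\ ?B => arith A; arith B
  end.

(* Boolean hypotheses that are not about numbers blow up the case analysis of [lia],
   and comparing cardinals up to conversion unfolds finite sets. *)
Ltac card_lia :=
  repeat match goal with
  | H : ?P |- _ => match type of P with Prop => tryif arith P then fail else clear H end
  end;
  repeat match goal with
  | H : context [@card ?T ?m] |- _ => let n := fresh "n" in set (n := @card T m) in *; clearbody n
  | |- context [@card ?T ?m] => let n := fresh "n" in set (n := @card T m) in *; clearbody n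
  end; lia.

(** * Triples and path-freeness in local form *)

Section Triples.
Variable V : finType.
Implicit Types (a b c d u v x y z : V) (e f g S A D T : {set V})
  (H F : {set {set V}}).

Definition triples S : {set {set V}} := [set e : {set V} | (e \subset S) && (#|e| == 3)].

(* [g] is the middle edge of the path; see [containsP]. *)
Definition pfree H := forall e f g, e \in H -> f \in H -> g \in H ->
  [disjoint e & f] -> #|g :&: e| = 1 -> #|g :&: f| = 1 -> False.

Lemma card_triples S : #|triples S| = 'C(#|S|, 3).
Proof. by rewrite cards_draws. Qed.

Lemma in_triples S e : (e \in triples S) = (e \subset S) && (#|e| == 3).
Proof. by rewrite inE. Qed.

Lemma triplesS S A : S \subset A -> triples S \subset triples A.
Proof.
move=> sSA; apply/subsetP => e; rewrite !in_triples => /andP[h ->].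
by rewrite (subset_trans h sSA).
Qed.

Lemma pfreeS F H : F \subset H -> pfree H -> pfree F.
Proof.
move=> /subsetP sFH pH e f g eF fF gF.
by apply: pH; apply: sFH.
Qed.

Lemma cards3 a b c : a != b -> a != c -> b != c -> #|[set a; b; c]| = 3.
Proof.
move=> ab ac bc; rewrite setUC cardsU1 cards2 ab !inE negb_or.
by rewrite eq_sym ac eq_sym bc.
Qed.

Lemma cards1_meet g e x : x \in g -> x \in e ->
  (forall z, z \in g -> z \in e -> z = x) -> #|g :&: e| = 1.
Proof.
move=> xg xe h; apply/eqP/cards1P; exists x; apply/setP => z.
rewrite !inE; apply/andP/eqP => [[]|->] //; exact: h.
Qed.

(** The form in which path-freeness gets applied: [g] is the middle edge and [x], [y] are its
    joints. Disjointness and intersections are phrased by membership so that [mem_solve] can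
    discharge them. *)
Lemma pfree_meet H e f g x y : pfree H -> e \in H -> f \in H -> g \in H ->
  (forall z, z \in e -> z \in f -> False) ->
  x \in g -> x \in e -> y \in g -> y \in f ->
  (forall z, z \in g -> z \in e -> z = x) ->
  (forall z, z \in g -> z \in f -> z = y) -> False.
Proof.
move=> pH eH fH gH dis xg xe yg yf mx my; apply: (pH e f g) => //.
- by rewrite disjoint_subset; apply/subsetP => z ze; apply/negP => /(dis z ze).
- exact: cards1_meet mx.
- exact: cards1_meet my.
Qed.

Lemma triple_pick3 e : #|e| = 3 ->
  exists x y z, [/\ e = [set x; y; z], x != y, x != z & y != z].
Proof.
move=> e3; have /card_gt0P[x xe] : 0 < #|e| by rewrite e3.
have c2 : #|e :\ x| = 2 by have := cardsD1 x e; rewrite e3 xe; lia.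
have /cards2P[y [z [nyz exyz]]] : #|e :\ x| == 2 by rewrite c2.
exists x, y, z; have : x \notin e :\ x by rewrite !inE eqxx.
rewrite exyz !inE negb_or => /andP[-> ->]; split=> //.
by rewrite -setUA -exyz setD1K.
Qed.

Lemma triple_pick2 e x : #|e| = 3 -> x \in e ->
  exists y z, [/\ e = [set x; y; z], x != y, x != z & y != z].
Proof.
move=> e3 xe.
have c2 : #|e :\ x| = 2 by have := cardsD1 x e; rewrite e3 xe; lia.
have /cards2P[y [z [nyz exyz]]] : #|e :\ x| == 2 by rewrite c2.
exists y, z; have : x \notin e :\ x by rewrite !inE eqxx.
rewrite exyz !inE negb_or => /andP[-> ->]; split=> //.
by rewrite -setUA -exyz setD1K.
Qed.

Lemma triple_pick1 e x y : #|e| = 3 -> x \in e -> y \in e -> x != y ->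
  exists z, [/\ e = [set x; y; z], x != z & y != z].
Proof.
move=> e3 xe ye xy; have [u [v [ee xu xv uv]]] := triple_pick2 e3 xe.
move: ye; rewrite ee !inE eq_sym (negbTE xy) /= => /orP[] /eqP ->.
- by exists v.
- exists u; rewrite xu [v == u]eq_sym uv; split=> //.
  by rewrite -!setUA (setUC [set u]).
Qed.

Lemma triple_eq e x y z : #|e| = 3 -> x \in e -> y \in e -> z \in e ->
  x != y -> x != z -> y != z -> e = [set x; y; z].
Proof.
move=> e3 xe ye ze xy xz yz; apply/esym/eqP; rewrite eqEcard e3 cards3 // leqnn andbT.
by apply/subsetP => u; mem_solve.
Qed.

End Triples.

(** * Intersecting graphs *)

Section Graphs.
Variable V : finType.
Implicit Types (a b c d u v w x y z : V) (p q e f g S A D T X : {set V})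
  (G H F : {set {set V}}).

Definition pairs X : {set {set V}} := [set p : {set V} | (p \subset X) && (#|p| == 2)].

Definition meet p q := ~~ [disjoint p & q].

Lemma meetP p q : reflect (exists2 z, z \in p & z \in q) (meet p q).
Proof.
rewrite /meet -setI_eq0; apply: (iffP (set0Pn _)) => [[z]|[z zp zq]].
  by rewrite inE => /andP[]; exists z.
by exists z; rewrite inE zp.
Qed.

Lemma meetC p q : meet p q = meet q p.
Proof. by rewrite /meet disjoint_sym. Qed.

Lemma pairsP X p : p \in pairs X -> p \subset X /\ #|p| = 2.
Proof. by rewrite inE => /andP[-> /eqP]. Qed.

Lemma card_pairs X : #|pairs X| = 'C(#|X|, 2).
Proof. by rewrite cards_draws. Qed.

Lemma pair_pick p : #|p| = 2 -> exists u v, p = [set u; v] /\ u != v.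
Proof. by move=> /eqP/cards2P[u [v [uv ->]]]; exists u, v. Qed.

Lemma pair_pick1 p u : #|p| = 2 -> u \in p -> exists v, p = [set u; v] /\ u != v.
Proof.
move=> /pair_pick[x [y [-> xy]]]; rewrite !inE => /orP[]/eqP->.
  by exists y.
by exists x; rewrite setUC eq_sym.
Qed.

Lemma card_cover (I : finType) (h : I -> {set V}) (B : {set I}) F :
  (forall e, e \in F -> exists2 i, i \in B & e = h i) -> #|F| <= #|B|.
Proof.
move=> hF; apply: leq_trans (leq_imset_card h (mem B)).
apply: subset_leq_card; apply/subsetP => e /hF[i iB ->]; exact: imset_f.
Qed.

Lemma card_leU F F1 F2 : F \subset F1 :|: F2 -> #|F| <= #|F1| + #|F2|.
Proof. by move/subset_leq_card => h; apply: leq_trans h (leq_card_setU F1 F2). Qed.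

Lemma pairs_star G X u : G \subset pairs X -> (forall p, p \in G -> u \in p) ->
  #|G| <= #|X|.-1.
Proof.
move=> /subsetP sG hu; have [->|/set0Pn[p0 p0G]] := eqVneq G set0; first by rewrite cards0.
have /pairsP[/subsetP sp _] := sG _ p0G.
have uX : u \in X := sp _ (hu _ p0G).
have -> : #|X|.-1 = #|X :\ u| by have := cardsD1 u X; rewrite uX; card_lia.
apply: (@card_cover _ (fun v => [set u; v])) => p pG.
have /pairsP[/subsetP spX p2] := sG _ pG.
have [v [ep uv]] := pair_pick1 p2 (hu _ pG).
exists v => //; rewrite !inE eq_sym uv spX // ep; mem_solve.
Qed.

(** At most |X| - 1 pairs contain u, and at most |X| - 2 contain v but not u. *)
Lemma pairs_meet1 G X u v : G \subset pairs X -> u \in X -> v \in X -> u != v ->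
  (forall p, p \in G -> meet [set u; v] p) -> #|G| <= #|X|.*2 - 3.
Proof.
move=> sG uX vX uv hm.
pose G1 := [set p in G | u \in p]; pose G2 := G :\: G1.
have l1 : #|G1| <= #|X|.-1.
  apply: (@pairs_star _ _ u) => [|p]; last by rewrite inE => /andP[].
  by apply: subset_trans sG; apply/subsetP => p; rewrite inE => /andP[].
have l2 : #|G2| <= #|X :\ u :\ v|.
  apply: (@card_cover _ (fun z => [set v; z])) => p; rewrite !inE => /andP[+ pG].
  rewrite pG /= => up; have /pairsP[/subsetP spX p2] := subsetP sG _ pG.
  have vp : v \in p.
    by have /meetP[z] := hm _ pG; rewrite !inE => /orP[]/eqP-> // h; rewrite h in up.
  have [z [ep vz]] := pair_pick1 p2 vp.
  have zp : z \in p by rewrite ep !inE eqxx orbT.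
  exists z => //; rewrite !inE (spX z zp) andbT eq_sym vz /=.
  by apply: contraNneq up => <-.
have c1 := cardsD1 u X; have c2 := cardsD1 v (X :\ u).
rewrite uX in c1; rewrite !inE vX eq_sym uv /= in c2.
have : #|G| <= #|G1| + #|G2|.
  by apply: card_leU; apply/subsetP => p pG; rewrite /G2 !inE pG; case: (u \in p).
card_lia.
Qed.

(** A pair missing u must contain both v and w, so vw is the only exception to the star at u. *)
Lemma pairs_meet2 G X u v w : G \subset pairs X -> u != v -> u != w -> v != w ->
  (forall p, p \in G -> meet [set u; v] p) ->
  (forall p, p \in G -> meet [set u; w] p) -> #|G| <= #|X|.-1 + 1.
Proof.
move=> sG uv uw vw h1 h2; pose G1 := [set p in G | u \in p].
have l1 : #|G1| <= #|X|.-1.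
  apply: (@pairs_star _ _ u) => [|p]; last by rewrite inE => /andP[].
  by apply: subset_trans sG; apply/subsetP => p; rewrite inE => /andP[].
have : #|G| <= #|G1| + #|[set [set v; w]]|.
  apply: card_leU; apply/subsetP => p pG; rewrite in_setU inE pG /=.
  case up: (u \in p) => //=; rewrite in_set1.
  have /pairsP[_ p2] := subsetP sG _ pG.
  have vp : v \in p.
    by have /meetP[z] := h1 _ pG; rewrite !inE => /orP[]/eqP-> // h; rewrite h in up.
  have wp : w \in p.
    by have /meetP[z] := h2 _ pG; rewrite !inE => /orP[]/eqP-> // h; rewrite h in up.
  rewrite eq_sym eqEcard p2 cards2 vw andbT.
  by apply/subsetP => z; mem_solve.
by rewrite cards1; card_lia.
Qed.

Lemma pairs_meet_disj G X p q : G \subset pairs X -> #|p| = 2 -> #|q| = 2 ->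
  [disjoint p & q] -> (forall r, r \in G -> meet p r) ->
  (forall r, r \in G -> meet q r) -> #|G| <= 4.
Proof.
move=> sG p2 q2 dpq h1 h2; have -> : 4 = #|setX p q| by rewrite cardsX p2 q2.
apply: (@card_cover _ (fun i => [set i.1; i.2])) => r rG.
have /meetP[x xp xr] := h1 _ rG; have /meetP[y yq yr] := h2 _ rG.
exists (x, y); rewrite ?inE ?xp //=.
have /pairsP[_ r2] := subsetP sG _ rG.
have xy : x != y by apply: contraTneq yq => <-; rewrite (disjointFr dpq xp).
apply/esym/eqP; rewrite eqEcard r2 cards2 xy andbT.
by apply/subsetP => z; mem_solve.
Qed.

Lemma pairs_two_meeting p q : #|p| = 2 -> #|q| = 2 -> p != q -> meet p q ->
  exists u v w, [/\ p = [set u; v], q = [set u; w] & [/\ u != v, u != w & v != w]].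
Proof.
move=> p2 q2 pq /meetP[u up uq].
have [v [ep uv]] := pair_pick1 p2 up; have [w [eq uw]] := pair_pick1 q2 uq.
exists u, v, w; split=> //; split=> //; apply: contraNneq pq => vw.
by rewrite ep eq vw.
Qed.

Definition intersecting F := forall p q, p \in F -> q \in F -> meet p q.

(** An intersecting graph is a star or lies in a triangle: if uv and uw are edges and some edge
    misses u, that edge is vw and nothing else fits. *)
Lemma pairs_intersecting G X : G \subset pairs X -> intersecting G ->
  #|G| <= maxn 3 #|X|.-1.
Proof.
move=> sG iG; have [small|big] := leqP #|G| 1; first by rewrite leq_max; apply/orP; left; card_lia.
have /card_gt1P[p [q [pG qG pq]]] := big.
have [/pairsP[_ p2] /pairsP[_ q2]] := (subsetP sG _ pG, subsetP sG _ qG).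
have [u [v [w [ep eq [uv uw vw]]]]] := pairs_two_meeting p2 q2 pq (iG _ _ pG qG).
rewrite leq_max; have [all|] := boolP [forall r in G, u \in r].
  by rewrite (@pairs_star _ X u) ?orbT // => r; apply/implyP; move/forallP: all.
rewrite negb_forall => /existsP[r]; rewrite negb_imply => /andP[rG ur].
suff /subset_leq_card : G \subset pairs [set u; v; w].
  by rewrite card_pairs cards3 // => ->.
have inr x : meet [set u; x] r -> x \in r.
  by case/meetP=> z; rewrite !inE => /orP[]/eqP-> // h; rewrite h in ur.
have vr : v \in r by apply: inr; rewrite -ep; apply: iG.
have wr : w \in r by apply: inr; rewrite -eq; apply: iG.
have /pairsP[_ r2] := subsetP sG _ rG.
have er : r = [set v; w].
  apply/esym/eqP; rewrite eqEcard r2 cards2 vw andbT.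
  by apply/subsetP => z; mem_solve.
apply/subsetP => s sG'; have /pairsP[_ s2] := subsetP sG _ sG'.
rewrite inE s2 eqxx andbT.
have m1 := iG _ _ pG sG'; have m2 := iG _ _ qG sG'; have m3 := iG _ _ rG sG'.
rewrite ep in m1; rewrite eq in m2; rewrite er in m3.
have in2 x y : x \in s -> y \in s -> x != y -> s = [set x; y].
  move=> xs ys xy; apply/esym/eqP; rewrite eqEcard s2 cards2 xy andbT.
  by apply/subsetP => z; mem_solve.
have [us|us] := boolP (u \in s).
  have /meetP[z] := m3; rewrite !inE => /orP[]/eqP-> zs.
    by rewrite (in2 _ _ us zs uv); apply/subsetP => t; mem_solve.
  by rewrite (in2 _ _ us zs uw); apply/subsetP => t; mem_solve.
have vs : v \in s by have /meetP[z] := m1; rewrite !inE => /orP[]/eqP-> // h; rewrite h in us.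
have ws : w \in s by have /meetP[z] := m2; rewrite !inE => /orP[]/eqP-> // h; rewrite h in us.
by rewrite (in2 _ _ vs ws vw); apply/subsetP => t; mem_solve.
Qed.

(** If one side is a single pair, the other has at most 2|X| - 3. Otherwise a side containing two
    disjoint pairs limits the other to 4, while two meeting pairs limit it to |X|. *)
Lemma cross_intersecting_pairs G1 G2 X : G1 \subset pairs X -> G2 \subset pairs X ->
  5 <= #|X| -> 0 < #|G1| -> 0 < #|G2| ->
  (forall p q, p \in G1 -> q \in G2 -> meet p q) ->
  #|G1| + #|G2| <= maxn (#|X|.*2 - 2) (#|X| + 4).
Proof.
have single F1 F2 : F1 \subset pairs X -> F2 \subset pairs X -> #|F2| = 1 ->
  (forall p q, p \in F1 -> q \in F2 -> meet p q) -> #|F1| <= #|X|.*2 - 3.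
  move=> s1 s2 /eqP/cards1P[q eq] hm.
  have qF : q \in F2 by rewrite eq inE.
  have /pairsP[/subsetP qX q2] := subsetP s2 _ qF.
  have [u [v [e uv]]] := pair_pick q2.
  apply: (pairs_meet1 s1 (u := u) (v := v)) => //; rewrite ?qX ?e ?inE ?eqxx ?orbT //.
  by move=> p pF; rewrite -e meetC; apply: hm.
have disj F1 F2 : F1 \subset pairs X -> F2 \subset pairs X ->
  (forall p q, p \in F1 -> q \in F2 -> meet p q) -> intersecting F2 \/ #|F1| <= 4.
  move=> s1 s2 hm; have [h|] := boolP [forall p in F2, forall q in F2, meet p q].
    left=> p q pF qF; move/forallP: h => /(_ p); rewrite pF /= => /forallP/(_ q).
    by rewrite qF.
  rewrite negb_forall => /existsP[p]; rewrite negb_imply negb_forall.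
  move=> /andP[pF] /existsP[q]; rewrite negb_imply negbK => /andP[qF dpq]; right.
  have [/pairsP[_ p2] /pairsP[_ q2]] := (subsetP s2 _ pF, subsetP s2 _ qF).
  by apply: (pairs_meet_disj s1 p2 q2 dpq) => r rF; rewrite meetC; apply: hm.
have two F1 F2 : F1 \subset pairs X -> F2 \subset pairs X -> intersecting F2 ->
  1 < #|F2| -> (forall p q, p \in F1 -> q \in F2 -> meet p q) -> #|F1| <= #|X|.-1 + 1.
  move=> s1 s2 i2 /card_gt1P[p [q [pF qF pq]]] hm.
  have [/pairsP[_ p2] /pairsP[_ q2]] := (subsetP s2 _ pF, subsetP s2 _ qF).
  have [u [v [w [ep eq [uv uw vw]]]]] := pairs_two_meeting p2 q2 pq (i2 _ _ pF qF).
  by apply: (pairs_meet2 s1 uv uw vw) => r rF; rewrite -?ep -?eq meetC; apply: hm.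
move=> s1 s2 X5 n1 n2 hm.
have hm' p q : p \in G2 -> q \in G1 -> meet p q by move=> *; rewrite meetC; apply: hm.
have [e1|ne1] := eqVneq #|G1| 1; first by have := single _ _ s2 s1 e1 hm'; card_lia.
have [e2|ne2] := eqVneq #|G2| 1; first by have := single _ _ s1 s2 e2 hm; card_lia.
(* When neither side is intersecting the total is at most 4 + 4, which [5 <= #|X|] puts below 2|X| -
   2. *)
have [i2|l1] := disj _ _ s1 s2 hm; have [i1|l2] := disj _ _ s2 s1 hm'; try card_lia.
- by have := pairs_intersecting s1 i1; have := pairs_intersecting s2 i2; card_lia.
- have g2 : 1 < #|G2| by card_lia.
  by have := two _ _ s1 s2 i2 g2 hm; card_lia.
- have g1 : 1 < #|G1| by card_lia.
  by have := two _ _ s2 s1 i1 g1 hm'; card_lia.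
Qed.

End Graphs.

(** * Intersecting triple systems *)

Section Intersecting.
Variable V : finType.
Implicit Types (a b c d u v w x y z : V) (p q e f g S A D T X : {set V})
  (G H F : {set {set V}}).

(** The link graph of [x]; it is applied to families all of whose edges contain [x], where removing
    [x] is injective. *)
Definition link x F : {set {set V}} := [set e :\ x | e in F].

Lemma card_link x F : (forall e, e \in F -> x \in e) -> #|link x F| = #|F|.
Proof.
move=> hx; apply: card_in_imset => e f /hx xe /hx xf ef.
by rewrite -(setD1K xe) ef setD1K.
Qed.

Lemma link_pairs x F S X : F \subset triples S -> (forall e, e \in F -> x \in e) ->
  (forall e u, e \in F -> u \in e -> u != x -> u \in X) -> link x F \subset pairs X.
Proof.
move=> /subsetP sF hx hX; apply/subsetP => p /imsetP[e eF ->].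
have := sF _ eF; rewrite inE => /andP[_ /eqP e3].
rewrite inE; apply/andP; split.
  by apply/subsetP => u; rewrite !inE => /andP[ux ue]; apply: hX ue ux.
by have := cardsD1 x e; rewrite hx // e3; card_lia.
Qed.

Lemma tripleP S H e : H \subset triples S -> e \in H -> e \subset S /\ #|e| = 3.
Proof. by move=> /subsetP sH /sH; rewrite inE => /andP[-> /eqP]. Qed.

Lemma codegree_le S H X x y : H \subset triples S -> x != y ->
  (forall e z, e \in H -> x \in e -> y \in e -> z \in e -> z != x -> z != y -> z \in X) ->
  #|[set e in H | (x \in e) && (y \in e)]| <= #|X|.
Proof.
move=> sH xy hX; apply: (@card_cover _ _ (fun z => [set x; y; z])) => e.
rewrite inE => /and3P[eH xe ye]; have [_ e3] := tripleP sH eH.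
have [z [ee xz yz]] := triple_pick1 e3 xe ye xy.
have ze : z \in e by rewrite ee !inE eqxx !orbT.
by exists z => //; apply: hX eH xe ye ze _ _; rewrite eq_sym.
Qed.

(** At most |S| - 2 edges contain both x and y. The others split into a link at x and a link at y,
    which are cross-intersecting graphs on |S| - 2 vertices, both nonempty because H is not a
    star. *)
Lemma intersecting_cover2 S H x y : H \subset triples S -> intersecting H ->
  7 <= #|S| -> x \in S -> y \in S -> x != y ->
  (forall z, ~ forall e, e \in H -> z \in e) ->
  (forall e, e \in H -> (x \in e) || (y \in e)) ->
  #|H| <= (#|S| - 2) + maxn (#|S|.*2 - 6) (#|S| + 2).
Proof.
move=> sH iH S7 xS yS xy nstar cov; set X := S :\ x :\ y.
have cX : #|X| = #|S| - 2.
  have := cardsD1 x S; have := cardsD1 y (S :\ x).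
  by rewrite xS !inE yS eq_sym xy /= /X; card_lia.
pose Hx := [set e in H | y \notin e]; pose Hy := [set e in H | x \notin e].
have xHx e : e \in Hx -> x \in e.
  by rewrite inE => /andP[/cov]; case: (x \in e) => //= ->.
have yHy e : e \in Hy -> y \in e.
  by rewrite inE => /andP[/cov]; case: (y \in e) => //=; rewrite orbF => ->.
have sub F : F \subset H -> F \subset triples S by move/subset_trans; apply.
have sHx : Hx \subset H by apply/subsetP => e; rewrite inE => /andP[].
have sHy : Hy \subset H by apply/subsetP => e; rewrite inE => /andP[].
have px : link x Hx \subset pairs X.
  apply: (link_pairs (sub _ sHx) xHx) => e u; rewrite inE => /andP[eH ye] ue ux.
  have [/subsetP eS _] := tripleP sH eH; rewrite !inE ux eS // ?andbT /=.
  by apply: contraNneq ye => <-.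
have py : link y Hy \subset pairs X.
  apply: (link_pairs (sub _ sHy) yHy) => e u; rewrite inE => /andP[eH xe] ue uy.
  have [/subsetP eS _] := tripleP sH eH; rewrite !inE uy eS // ?andbT /=.
  by apply: contraNneq xe => <-.
have nonempty z : 0 < #|[set e in H | z \notin e]|.
  rewrite card_gt0; apply/negP => /eqP h; apply: (nstar z) => e eH.
  apply: contraT => ze; suff : e \in set0 by rewrite inE.
  by rewrite -h inE eH ze.
have cross : forall p q, p \in link x Hx -> q \in link y Hy -> meet p q.
  move=> p q /imsetP[e eF ->] /imsetP[f fF ->].
  move: eF fF; rewrite !inE => /andP[eH ye] /andP[fH xf].
  have /meetP[z ze zf] := iH _ _ eH fH; apply/meetP; exists z; rewrite !inE ?ze ?zf andbT.
    by apply: contraNneq xf => <-.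
  by apply: contraNneq ye => <-.
have := cross_intersecting_pairs px py _ _ _ cross.
rewrite !card_link // cX => /(_ _ (nonempty y) (nonempty x)) h.
have l12 : #|[set e in H | (x \in e) && (y \in e)]| <= #|X|.
  apply: (codegree_le sH xy) => e z eH _ _ ze zx zy; rewrite !inE zx zy.
  by have [/subsetP eS _] := tripleP sH eH; apply: eS.
have : #|H| <= #|[set e in H | (x \in e) && (y \in e)]| + #|Hx :|: Hy|.
  apply: card_leU; apply/subsetP => e eH; rewrite !inE eH.
  by case: (x \in e); case: (y \in e).
have := leq_card_setU Hx Hy => -[l _].
by have := h ltac:(card_lia); card_lia.
Qed.

(** Fix an edge E = xyz and count the other edges by their trace on E. A trace of two vertices is
    controlled by codegrees, a trace of one vertex by three pairwise cross-intersecting link graphs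
    outside E. The constant 19 is not sharp; it only has to stay below [second_max 8], which is
    20. *)
Lemma intersecting_no_cover2 S H : H \subset triples S -> intersecting H -> 7 <= #|S| ->
  H != set0 ->
  (forall x y, x != y -> exists e, [/\ e \in H, x \notin e & y \notin e]) ->
  #|H| <= if #|S| == 7 then 14 else 19.
Proof.
move=> sH iH S7 /set0Pn[E EH] tau.
(* W consists of the third vertices of the edges through x and y; an edge avoiding x and y can meet
   xyz only in z, so it contains all of W. *)
have codeg x y : x != y -> exists W : {set V}, #|[set e in H | (x \in e) && (y \in e)]| <= #|W| /\
    forall e, e \in H -> x \notin e -> y \notin e -> W \subset e.
  move=> xy; exists [set z | (z != x) && (z != y) && ([set x; y; z] \in H)]; split.
    apply: (codegree_le sH xy) => e z eH xe ye ze zx zy; rewrite inE zx zy /=.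
    have [_ e3] := tripleP sH eH.
    by rewrite -(triple_eq e3 xe ye ze xy) // eq_sym.
  move=> e eH xe ye; apply/subsetP => z; rewrite inE => /andP[/andP[zx zy] zH].
  have /meetP[t] := iH _ _ zH eH; rewrite !inE => /orP[/orP[]|]/eqP-> // h.
    by rewrite h in xe.
  by rewrite h in ye.
have codeg3 x y : x != y -> #|[set e in H | (x \in e) && (y \in e)]| <= 3.
  move=> xy; have [W [lW hW]] := codeg x y xy; have [e [eH xe ye]] := tau x y xy.
  have [_ <-] := tripleP sH eH.
  exact: leq_trans lW (subset_leq_card (hW _ eH xe ye)).
pose G x y z := [set e in H | [&& x \in e, y \notin e & z \notin e]].
have sG x y z : G x y z \subset triples S.
  by apply: subset_trans sH; apply/subsetP => e; rewrite inE => /andP[].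
have xG x y z e : e \in G x y z -> x \in e by rewrite inE => /and4P[].
(* With codegree 3 the set W has at least three elements, so an edge avoiding x and y must be W
   itself. *)
have codeg_G x y z : x != y ->
    #|[set e in H | (x \in e) && (y \in e)]| = 3 -> #|G z x y| <= 1.
  move=> xy c3; have [W [lW hW]] := codeg x y xy.
  rewrite leqNgt; apply/negP => /card_gt1P[e [f [eG fG ef]]].
  move: eG fG; rewrite !inE => /and4P[eH _ xe ye] /and4P[fH _ xf yf].
  have eqW e' : e' \in H -> x \notin e' -> y \notin e' -> W = e'.
    move=> e'H xe' ye'; apply/eqP; rewrite eqEcard hW //=.
    by have [_ ->] := tripleP sH e'H; rewrite -c3.
  by move: ef; rewrite -(eqW e) // -(eqW f) // eqxx.
have [_ E3] := tripleP sH EH.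
have [x [y [z [eE xy xz yz]]]] := triple_pick3 E3.
set X := S :\: E.
have cX : #|X| = #|S| - 3.
  have [ES _] := tripleP sH EH.
  by rewrite /X cardsD (setIidPr ES) E3.
have lG a b c : E = [set a; b; c] -> link a (G a b c) \subset pairs X.
  move=> e1; apply: (link_pairs (sG a b c) (@xG a b c)) => e u.
  rewrite inE => /and4P[eH _ be ce] ue ua; have [/subsetP eS _] := tripleP sH eH.
  rewrite inE e1 !inE (negbTE ua) eS // andbT /= negb_or.
  by apply/andP; split; [apply: contraNneq be|apply: contraNneq ce] => <-.
have cross a b c : E = [set a; b; c] -> E = [set b; a; c] ->
    forall p q, p \in link a (G a b c) -> q \in link b (G b a c) -> meet p q.
  move=> e1 e2 p q /imsetP[e eF ->] /imsetP[f fF ->].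
  move: eF fF; rewrite !inE => /and4P[eH ae be ce] /and4P[fH bf af cf].
  have /meetP[t te tf] := iH _ _ eH fH; apply/meetP; exists t; rewrite !inE ?te ?tf andbT.
    by apply: contraNneq af => <-.
  by apply: contraNneq be => <-.
have ne a b c : E = [set a; b; c] -> b != c -> 0 < #|G a b c|.
  move=> e1 bc; have [e [eH be ce]] := tau b c bc; apply/card_gt0P; exists e.
  rewrite inE eH be ce; have /meetP[t] := iH _ _ EH eH.
  rewrite e1 !inE => /orP[/orP[]|]/eqP-> h; first by rewrite h.
    by rewrite h in be.
  by rewrite h in ce.
have star3 a b c u : E = [set a; b; c] -> u \in X ->
    #|[set p in link a (G a b c) | u \in p]| <= 3.
  move=> e1 uX; have au : a != u.
    by apply: contraTneq uX => <-; rewrite inE e1 !inE eqxx.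
  apply: leq_trans (codeg3 _ _ au).
  have -> : #|[set e in H | (a \in e) && (u \in e)]| =
            #|link a [set e in H | (a \in e) && (u \in e)]|.
    by rewrite card_link // => e; rewrite inE => /and3P[].
  apply: subset_leq_card; apply/subsetP => p; rewrite inE => /andP[/imsetP[e eG ->]].
  rewrite !inE => /andP[_ ue]; apply: imset_f; move: eG; rewrite !inE => /and4P[-> -> _ _].
  by rewrite ue.
(* Every link pair at a meets one fixed link pair at b, and each vertex of the latter has degree at
   most 3 in the link at a. *)
have small6 a b c : E = [set a; b; c] -> E = [set b; a; c] -> 0 < #|G b a c| ->
    #|G a b c| <= 6.
  move=> e1 e2; rewrite -(card_link (x := b) (F := G b a c)); last exact: xG.
  rewrite -(card_link (x := a) (F := G a b c)); last exact: xG.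
  move=> /card_gt0P[p pL]; have /pairsP[/subsetP pX p2] := subsetP (lG _ _ _ e2) _ pL.
  have [u [v [ep uv]]] := pair_pick p2.
  have uX : u \in X by apply: pX; rewrite ep !inE eqxx.
  have vX : v \in X by apply: pX; rewrite ep !inE eqxx orbT.
  have := star3 _ _ _ _ e1 uX; have := star3 _ _ _ _ e1 vX.
  suff : #|link a (G a b c)| <= #|[set p in link a (G a b c) | u \in p]| +
                          #|[set p in link a (G a b c) | v \in p]| by card_lia.
  apply: card_leU; apply/subsetP => q qL; rewrite in_setU !in_set qL /=.
  have /meetP[t tq] := cross _ _ _ e1 e2 _ _ qL pL.
  by rewrite ep !inE => /orP[]/eqP<-; rewrite tq ?orbT.
(* Two link pairs at b allow only 2 * 2 pairs if they are disjoint; if they are uv and uw, at most 3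
   pairs through u and the pair vw. *)
have small4 a b c : E = [set a; b; c] -> E = [set b; a; c] -> 1 < #|G b a c| ->
    #|G a b c| <= 4.
  move=> e1 e2; rewrite -(card_link (x := b) (F := G b a c)); last exact: xG.
  rewrite -(card_link (x := a) (F := G a b c)); last exact: xG.
  move=> /card_gt1P[p [q [pL qL pq]]].
  have /pairsP[/subsetP pX p2] := subsetP (lG _ _ _ e2) _ pL.
  have /pairsP[/subsetP qX q2] := subsetP (lG _ _ _ e2) _ qL.
  have [mpq|] := boolP (meet p q); last first.
    rewrite negbK => dpq; apply: (pairs_meet_disj (lG _ _ _ e1) p2 q2 dpq) => r rL.
      by rewrite meetC; apply: cross e1 e2 _ _ rL pL.
    by rewrite meetC; apply: cross e1 e2 _ _ rL qL.
  have [u [v [w [ep eq [uv uw vw]]]]] := pairs_two_meeting p2 q2 pq mpq.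
  have uX : u \in X by apply: pX; rewrite ep !inE eqxx.
  have := star3 _ _ _ _ e1 uX.
  suff : #|link a (G a b c)| <= #|[set p in link a (G a b c) | u \in p]| +
                          #|[set [set v; w]]| by rewrite cards1; card_lia.
  apply: card_leU; apply/subsetP => r rL; rewrite in_setU !in_set rL /=.
  case ur: (u \in r) => //=.
  have /meetP[s sr] := cross _ _ _ e1 e2 _ _ rL pL.
  have /meetP[t tr] := cross _ _ _ e1 e2 _ _ rL qL.
  have /pairsP[_ r2] := subsetP (lG _ _ _ e1) _ rL.
  rewrite ep eq !inE => /orP[]/eqP et; first by rewrite -et tr in ur.
  move=> /orP[]/eqP es; first by rewrite -es sr in ur.
  subst s t; rewrite eq_sym eqEcard r2 cards2 vw andbT.
  by apply/subsetP => s; mem_solve.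
(* On four vertices the complement of a link pair at b is a pair disjoint from it, hence no link
   pair at a. The two links therefore share the 6 available pairs. *)
have compl a b c : #|S| = 7 -> E = [set a; b; c] -> E = [set b; a; c] ->
    #|G a b c| + #|G b a c| <= 6.
  move=> c7 e1 e2; rewrite -(card_link (x := b) (F := G b a c)); last exact: xG.
  rewrite -(card_link (x := a) (F := G a b c)); last exact: xG.
  pose M := [set X :\: p | p in link b (G b a c)].
  have X4 : #|X| = 4 by rewrite cX c7.
  have pX p : p \in link b (G b a c) -> p \subset X /\ #|p| = 2.
    by move=> pL; apply: pairsP; apply: (subsetP (lG _ _ _ e2)).
  have -> : #|link b (G b a c)| = #|M|.
    apply/esym/card_in_imset => p q /pX[pX' _] /pX[qX' _] epq.
    have DK (r : {set V}) : r \subset X -> X :\: (X :\: r) = r.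
      by move=> rX; rewrite setDDr setDv set0U (setIidPr rX).
    by rewrite -(DK _ pX') epq DK.
  have -> : 6 = #|pairs X| by rewrite card_pairs X4.
  rewrite -cardsUI; suff -> : link a (G a b c) :&: M = set0.
    rewrite cards0 addn0; apply: subset_leq_card; rewrite subUset lG //=.
    apply/subsetP => r /imsetP[p /pX[pX' p2] ->].
    by rewrite inE subsetDl cardsD (setIidPr pX') p2 X4.
  apply/setP => r; rewrite in_set0 in_setI; apply/negP => /andP[rL /imsetP[p pL er]].
  have /meetP[t] := cross _ _ _ e1 e2 _ _ rL pL.
  by rewrite er inE => /andP[/negP].
pose C a b := [set e in H | (a \in e) && (b \in e)].
have EC a b c : E = [set a; b; c] -> E \in C a b.
  by move=> e1; rewrite inE EH e1 !inE !eqxx orbT.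
have Exzy : E = [set x; z; y] by rewrite eE -setUA (setUC [set y]) setUA.
have Eyxz : E = [set y; x; z] by rewrite eE (setUC [set x]).
have Eyzx : E = [set y; z; x] by rewrite Eyxz -setUA (setUC [set x]) setUA.
have Ezxy : E = [set z; x; y] by rewrite Exzy (setUC [set x]).
have Ezyx : E = [set z; y; x] by rewrite Eyzx (setUC [set y]).
have CD a b c : E = [set a; b; c] -> #|C a b| = #|C a b :\ E|.+1.
  by move=> e1; have := cardsD1 E (C a b); rewrite (EC _ _ _ e1).
have GC a b c : G a b c = G a c b by apply/setP => e; rewrite !inE (andbC (b \notin e)).
have bound : #|H| <= 1 + #|C x y :\ E| + #|C x z :\ E| + #|C y z :\ E| +
    #|G x y z| + #|G y x z| + #|G z x y|.
  have -> : 1 = #|[set E]| by rewrite cards1.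
  have U (A B : {set {set V}}) : #|A :|: B| <= #|A| + #|B| := (leq_card_setU A B).1.
  rewrite -!addnA; apply: leq_trans (_ : #|[set E] :|: (C x y :\ E :|: (C x z :\ E :|:
    (C y z :\ E :|: (G x y z :|: (G y x z :|: G z x y)))))| <= _); last first.
    by do 5! (apply: (leq_trans (U _ _)); rewrite leq_add2l); exact: U.
  apply: subset_leq_card; apply/subsetP => e eH; rewrite !inE eH /=.
  have /meetP[t] := iH _ _ EH eH; rewrite eE !inE => /orP[/orP[]|]/eqP-> ->;
  by case: (e == _) => //=; case: (x \in e); case: (y \in e); case: (z \in e).
have cxy := codeg3 _ _ xy; have cxz := codeg3 _ _ xz; have cyz := codeg3 _ _ yz.
have gxy := codeg_G _ _ z xy; have gxz := codeg_G _ _ y xz; have gyz := codeg_G _ _ x yz.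
rewrite -/(C x y) (CD _ _ _ eE) in cxy gxy.
rewrite -/(C x z) (CD _ _ _ Exzy) in cxz gxz.
rewrite -/(C y z) (CD _ _ _ Eyzx) in cyz gyz.
have nx := ne _ _ _ eE yz; have ny := ne _ _ _ Eyxz xz; have nz := ne _ _ _ Ezxy xy.
have a1 := small6 _ _ _ eE Eyxz ny; have a2 := small6 _ _ _ Eyxz eE nx.
have a3 := small6 _ _ _ Ezxy Exzy; rewrite (GC x z y) in a3; have {}a3 := a3 nx.
have b1 := small4 _ _ _ eE Eyxz; have b2 := small4 _ _ _ Eyxz eE.
have b3 := small4 _ _ _ Ezxy Exzy; have b4 := small4 _ _ _ Exzy Ezxy.
have b5 := small4 _ _ _ Ezyx Eyzx; have b6 := small4 _ _ _ Eyzx Ezyx.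
rewrite (GC x z y) in b3 b4; rewrite (GC y z x) (GC z y x) in b5 b6.
have [c7|_] := eqVneq #|S| 7; last by card_lia.
have k1 := compl _ _ _ c7 eE Eyxz; have k2 := compl _ _ _ c7 Exzy Ezxy.
have k3 := compl _ _ _ c7 Eyzx Ezyx.
rewrite (GC x z y) in k2; rewrite (GC y z x) (GC z y x) in k3.
card_lia.
Qed.

Lemma intersecting_nontrivial S H : H \subset triples S -> intersecting H -> 7 <= #|S| ->
  (forall z, ~ forall e, e \in H -> z \in e) ->
  #|H| <= if #|S| == 7 then 14 else maxn 19 (3 * #|S| - 8).
Proof.
move=> sH iH S7 nstar.
have [->|H0] := eqVneq H set0; first by rewrite cards0.
have [/existsP[x /existsP[y /andP[xy cov]]]|] :=
    boolP [exists x, exists y, (x != y) && [forall e in H, (x \in e) || (y \in e)]].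
  have {}cov e : e \in H -> (x \in e) || (y \in e).
    by move=> eH; move/forallP: cov => /(_ e); rewrite eH.
  have inS u v : (forall e, e \in H -> (u \in e) || (v \in e)) -> u \in S.
    move=> hc; apply: contraT => uS; exfalso; apply: (nstar v) => e eH.
    have [/subsetP eS _] := tripleP sH eH.
    by have /orP[/eS|//] := hc _ eH; rewrite (negbTE uS).
  have := @intersecting_cover2 S H x y sH iH S7 (inS _ _ cov).
  have yS : y \in S by apply: (inS y x) => e eH; rewrite orbC cov.
  by move=> /(_ yS xy nstar cov); case: ifP => [/eqP->|]; card_lia.
rewrite negb_exists => /forallP h.
have tau x y : x != y -> exists e, [/\ e \in H, x \notin e & y \notin e].
  move=> xy; have := h x; rewrite negb_exists => /forallP/(_ y).
  rewrite xy /= negb_forall => /existsP[e]; rewrite negb_imply negb_or.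
  by move=> /and3P[]; exists e.
by have := intersecting_no_cover2 sH iH S7 H0 tau; case: ifP => _; card_lia.
Qed.

End Intersecting.

(** * Books *)

Section Books.
Variable V : finType.
Implicit Types (a b c d u v w x y z : V) (p q r s e f g h S A D T X : {set V})
  (G H F : {set {set V}}).

Lemma cardsD1_in X x : x \in X -> #|X :\ x| = #|X| - 1.
Proof. by move=> xX; have := cardsD1 x X; rewrite xX; card_lia. Qed.

Lemma cardsD2 X x y : x \in X -> y \in X -> x != y -> #|X :\ x :\ y| = #|X| - 2.
Proof.
move=> xX yX xy; have := cardsD1 x X; have := cardsD1 y (X :\ x).
by rewrite !inE xX yX eq_sym xy /=; card_lia.
Qed.

(** Let xyz and xyw be two of the triples. Either every triple contains x and y, or a triple missing
    one of them forces every triple to have three of its vertices among x, y, z, w. *)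
Lemma pairwise_two_le F X : F \subset triples X ->
  (forall e f, e \in F -> f \in F -> 1 < #|e :&: f|) -> #|F| <= maxn 4 (#|X| - 2).
Proof.
move=> sF two; rewrite leq_max.
have [small|big] := leqP #|F| 1; first by apply/orP; left; card_lia.
have /card_gt1P[p [q [pF qF pq]]] := big.
have [[pX p3] [qX q3]] := (tripleP sF pF, tripleP sF qF).
have /card_gt1P[x [y [+ + xy]]] := two _ _ pF qF.
rewrite !inE => /andP[xp xq] /andP[yp yq].
have [z [ep xz yz]] := triple_pick1 p3 xp yp xy.
have [w [eq xw yw]] := triple_pick1 q3 xq yq xy.
have zw : z != w by apply: contraNneq pq => zw; rewrite ep eq zw.
have [all|] := boolP [forall r in F, (x \in r) && (y \in r)].
  apply/orP; right.
  rewrite -(cardsD2 (subsetP pX _ xp) (subsetP pX _ yp) xy).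
  apply: leq_trans (codegree_le (H := F) sF xy _).
    apply: subset_leq_card; apply/subsetP => r rF; rewrite inE rF.
    by move/forallP: all => /(_ r); rewrite rF.
  move=> r u rF _ _ ur ux uy; rewrite !inE ux uy.
  by have [/subsetP rX _] := tripleP sF rF; apply: rX.
rewrite negb_forall => /existsP[r]; rewrite negb_imply => /andP[rF nr].
apply/orP; left.
have two_of s u v t : u != v -> u != t -> v != t -> 1 < #|s :&: [set u; v; t]| ->
    [|| (u \in s) && (v \in s), (u \in s) && (t \in s) | (v \in s) && (t \in s)].
  move=> uv ut vt /card_gt1P[i [j [+ + ij]]]; rewrite !inE => /andP[is_ ei] /andP[js ej].
  by move: ei ej ij is_ js => /orP[/orP[]|]/eqP-> /orP[/orP[]|]/eqP->;
    rewrite ?eqxx // => _ -> ->; rewrite ?orbT.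
have Fp s : s \in F -> [|| (x \in s) && (y \in s), (x \in s) && (z \in s) | (y \in s) && (z \in s)].
  by move=> sF'; apply: two_of => //; rewrite -ep; apply: two.
have Fq s : s \in F -> [|| (x \in s) && (y \in s), (x \in s) && (w \in s) | (y \in s) && (w \in s)].
  by move=> sF'; apply: two_of => //; rewrite -eq; apply: two.
suff /subset_leq_card : F \subset triples ([set x; y; z] :|: [set w]).
  by rewrite card_triples setUC cardsU1 cards3 // !inE !negb_or !(eq_sym w) xw yw zw.
have [_ r3] := tripleP sF rF.
have Fr s : s \in F -> 2 < (x \in s) + (y \in s) + (z \in s) + (w \in s).
  move=> sF'; have := Fp _ sF'; have := Fq _ sF'.
  have := Fp _ rF; have := Fq _ rF; move: nr.
  have [xr|xr] := boolP (x \in r); have [yr|yr] := boolP (y \in r) => //= _.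
  - rewrite ?orbF => wr zr.
    have er := triple_eq r3 xr zr wr xz xw zw.
    have := two_of s x z w xz xw zw; rewrite -er => /(_ (two _ _ sF' rF)).
    by case: (x \in s); case: (y \in s); case: (z \in s); case: (w \in s).
  - rewrite ?orbF => wr zr.
    have er := triple_eq r3 yr zr wr yz yw zw.
    have := two_of s y z w yz yw zw; rewrite -er => /(_ (two _ _ sF' rF)).
    by case: (x \in s); case: (y \in s); case: (z \in s); case: (w \in s).
apply/subsetP => s sF'; have [_ s3] := tripleP sF sF'; rewrite inE s3 eqxx andbT.
have := Fr _ sF'.
case xs: (x \in s); case ys: (y \in s); case zs: (z \in s); case ws: (w \in s) => // _;
  [rewrite (triple_eq s3 xs ys zs) //|rewrite (triple_eq s3 xs ys zs) //
  |rewrite (triple_eq s3 xs ys ws) //|rewrite (triple_eq s3 xs zs ws) //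
  |rewrite (triple_eq s3 ys zs ws) //]; apply/subsetP => t; mem_solve.
Qed.

(** The edges are sorted by how many of a and b they contain: those with both form a book with spine
    ab and are recorded by their third vertex. *)
Definition pages a b H : {set V} := [set x | [set a; b; x] \in H].
Definition side a b H := [set e in H | (a \in e) != (b \in e)].
Definition rest a b H := [set e in H | (a \notin e) && (b \notin e)].

Lemma pagesC a b H : pages a b H = pages b a H.
Proof. by apply/setP => x; rewrite !inE (setUC [set a]). Qed.

Lemma pagesP a b H S x : H \subset triples S -> x \in pages a b H ->
  [/\ a != b, x != a, x != b & [/\ a \in S, b \in S & x \in S]].
Proof.
rewrite inE => sH xH; have [/subsetP eS e3] := tripleP sH xH.
have [ab xa xb] : [/\ a != b, x != a & x != b].
  split; apply/negP => /eqP e; move: e3; rewrite e.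
  - by rewrite setUid cards2; case: (_ != _).
  - by rewrite setUAC setUid cards2; case: (_ != _).
  - by rewrite -setUA setUid cards2; case: (_ != _).
by split=> //; split; apply: eS; rewrite !inE eqxx ?orbT.
Qed.

Lemma restP a b H e : e \in rest a b H -> [/\ e \in H, a \notin e & b \notin e].
Proof. by rewrite inE => /and3P[]. Qed.

Lemma card_book H S a b : H \subset triples S -> a != b ->
  #|H| <= #|pages a b H| + #|side a b H| + #|rest a b H|.
Proof.
move=> sH ab; have l1 : #|[set e in H | (a \in e) && (b \in e)]| <= #|pages a b H|.
  apply: (codegree_le sH ab) => e z eH ae be ze za zb; rewrite inE.
  have [_ e3] := tripleP sH eH.
  by rewrite -(triple_eq e3 ae be ze ab) // eq_sym.
have : #|H| <= #|[set e in H | (a \in e) && (b \in e)]| + #|side a b H :|: rest a b H|.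
  apply: card_leU; apply/subsetP => e eH; rewrite !inE eH.
  by case: (a \in e); case: (b \in e).
have := (leq_card_setU (side a b H) (rest a b H)).1; card_lia.
Qed.

(** A trace outside {a, b} comes from at most two edges: one through a and one through b. *)
Lemma side_le H a b (Q : {set {set V}}) :
  (forall e, e \in side a b H -> e :\ a :\ b \in Q) -> #|side a b H| <= 2 * #|Q|.
Proof.
move=> hQ; have -> : 2 * #|Q| = #|setX [set: bool] Q| by rewrite cardsX cardsT card_bool.
apply: (@card_cover _ _ (fun i => (if i.1 then a else b) |: i.2)) => e eB.
exists (a \in e, e :\ a :\ b); first by rewrite !inE /= hQ.
move: eB; rewrite inE => /andP[_]; case ae: (a \in e); case be: (b \in e) => //= _.
- by rewrite (_ : e :\ a :\ b = e :\ a) ?setD1K //; apply/setP => z; rewrite !inE;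
    case: eqVneq => //= ->; rewrite be andbF.
- by rewrite (_ : e :\ a :\ b = e :\ b) ?setD1K //; apply/setP => z; rewrite !inE;
    case: (eqVneq z a) => //= ->; rewrite ae andbF.
Qed.

Lemma side_card H S a b e : H \subset triples S -> e \in side a b H -> #|e :\ a :\ b| = 2.
Proof.
move=> sH; rewrite inE => /andP[eH]; have [_ e3] := tripleP sH eH.
have := cardsD1 a e; have := cardsD1 b (e :\ a); rewrite !inE.
by have [->|_] := eqVneq b a => /=; case: (a \in e); case: (b \in e) => //=; card_lia.
Qed.

(** If e missed D, then abd would join e to D at a and d. So e = ayz with y in D; a vertex z outside
    D and different from c would let e join abc to D at a and y. *)
Lemma pfree_one_side H S a b c d D e z : pfree H -> H \subset triples S ->
  c \in pages a b H -> d \in pages a b H -> D \in rest a b H -> d \in D -> c \notin D ->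
  e \in H -> a \in e -> b \notin e -> z \in e -> z != a -> (z \in D) || (z == c).
Proof.
move=> pH sH cT dT DR dD cD eH ae be ze za.
have [ab ca cb _] := pagesP sH cT; have [_ da db _] := pagesP sH dT.
have [DH aD bD] := restP DR; have [_ e3] := tripleP sH eH.
have [abc abd] : [set a; b; c] \in H /\ [set a; b; d] \in H by move: cT dT; rewrite !inE.
have /meetP[y ye yD] : meet e D.
  apply/meetP; have [/exists_inP[y] |no] := boolP [exists y in e, y \in D]; first by exists y.
  exfalso; have {}no y : y \in e -> y \in D -> False.
    by move=> ye yD; move/negP: no; apply; apply/exists_inP; exists y.
  have de : d \notin e by apply/negP => de; apply: no de dD.
  by apply: (pfree_meet (x := a) (y := d) pH eH DH abd); first [exact: no | mem_solve].
apply: contraT; rewrite negb_or => /andP[zD zc]; exfalso.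
have ya : y != a by apply: contraTneq yD => ->.
have yz : y != z by apply: contraNneq zD => <-.
have ee := triple_eq e3 ae ye ze; rewrite eq_sym in ya; rewrite (eq_sym z) in za.
have {}ee := ee ya za yz.
have yb : y != b by apply: contraNneq be => <-.
have zb : z != b by apply: contraNneq be => <-.
have yc : y != c by apply: contraTneq yD => ->.
by apply: (pfree_meet (x := a) (y := y) pH abc DH eH); rewrite ?ee; mem_solve.
Qed.

Lemma side_sub H S a b c d D e : pfree H -> H \subset triples S ->
  c \in pages a b H -> d \in pages a b H -> D \in rest a b H -> d \in D -> c \notin D ->
  e \in side a b H -> e :\ a :\ b \subset c |: D.
Proof.
move=> pH sH cT dT DR dD cD; rewrite inE => /andP[eH abe].
apply/subsetP => z; rewrite !inE => /and3P[zb za ze]; rewrite orbC.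
have DR' : D \in rest b a H by move: DR; rewrite !inE (andbC (a \notin D)).
move: abe; case ae: (a \in e); case be: (b \in e) => // _.
  by apply: (pfree_one_side pH sH cT dT DR dD cD eH ae _ ze za); rewrite be.
rewrite pagesC in cT dT.
by apply: (pfree_one_side pH sH cT dT DR' dD cD eH be _ ze zb); rewrite ae.
Qed.

Definition forked H := exists a b c d D D',
  [/\ c \in pages a b H /\ d \in pages a b H, D \in rest a b H /\ D' \in rest a b H,
      D :&: D' = [set d] & (c \notin D) && (c \notin D')].

(** Suppose D and D' share only z. A page y of D other than z gives a path: D joins aby to D'. So z
    is the only page in D, and likewise in D'; any second page then completes a fork. *)
Lemma unforked_meet H S a b x D D' : pfree H -> H \subset triples S -> ~ forked H ->
  1 < #|pages a b H| -> D \in rest a b H -> D' \in rest a b H ->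
  x \in pages a b H -> x \in D -> #|D :&: D'| != 1.
Proof.
move=> pH sH nf T2 DR D'R xT xD; apply/negP => /cards1P[z ez].
have inz y : y \in D -> y \in D' -> y = z.
  by move=> yD yD'; apply/set1P; rewrite -ez inE yD.
have [zD zD'] : z \in D /\ z \in D' by apply/andP; rewrite -in_setI ez inE.
have only E E' : E \in rest a b H -> E' \in rest a b H -> z \in E -> z \in E' ->
    (forall y, y \in E -> y \in E' -> y = z) ->
    forall y, y \in pages a b H -> y \in E -> y = z.
  move=> ER E'R zE zE' inz' y yT yE; apply/eqP; apply: contraT => yz; exfalso.
  have [ab ya yb _] := pagesP sH yT.
  have [[EH aE bE] [E'H aE' bE']] := (restP ER, restP E'R).
  have yH : [set a; b; y] \in H by rewrite inE in yT.
  have yE' : y \notin E' by apply: contraNN yz => yE'; rewrite (inz' y).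
  by apply: (pfree_meet (x := y) (y := z) pH yH E'H EH); try apply: inz'; mem_solve.
have xz := only _ _ DR D'R zD zD' inz x xT xD; subst x.
have /card_gt1P[c1 [c2 [c1T c2T c12]]] := T2.
have [c cT cz] : exists2 c, c \in pages a b H & c != z.
  have [e1|] := eqVneq c1 z; last by exists c1.
  by exists c2 => //; rewrite eq_sym -e1.
apply: nf; exists a, b, c, z, D, D'; split=> //; apply/andP; split; apply: contraNN cz => h; apply/eqP.
  exact: only DR D'R zD zD' inz c cT h.
by apply: only D'R DR zD' zD _ c cT h => y h1 h2; apply: inz.
Qed.

End Books.

(** * Extremal numbers and systems *)

(* Meaningful for [m >= 7] only. *)
Definition second_max m :=
  if m <= 7 then 15 else if m <= 12 then 20 + 'C(m - 6, 3) else 4 + 'C(m - 4, 2).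

(** On at most six vertices every triple system is P-free, hence the first value. *)
Definition first_max m :=
  if m <= 6 then 'C(m, 3) else if m == 7 then 20 else 'C(m - 1, 2).

(** * Numerical inequalities between the two Turan functions *)

Lemma binD2 n j : 'C(n + j, 2) = 'C(n, 2) + n * j + 'C(j, 2).
Proof.
elim: j => [|j IH]; first by rewrite addn0 muln0 !addn0.
by rewrite addnS !binS !bin1 IH; lia.
Qed.

Lemma first_max_large m : 8 <= m -> first_max m = 'C(m - 1, 2).
Proof. by rewrite /first_max => m8; rewrite !ifN //; lia. Qed.

Lemma second_max_large m : 13 <= m -> second_max m = 4 + 'C(m - 4, 2).
Proof. by rewrite /second_max => m8; rewrite !ifN //; lia. Qed.

Lemma first_max_mono m n : m <= n -> first_max m <= first_max n.
Proof.
move=> /subnK <-; elim: (n - m) => [|k IH] //; apply: (leq_trans IH) => {IH}.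
rewrite addSn; move: (k + m) => {k n}{}m.
have [m8|m8] := ltnP m 8; last first.
  by rewrite !first_max_large ?leq_bin2l; lia.
by do 8 (case: m m8 => [|m] m8 //).
Qed.

Lemma second_max_ge_star m : 8 <= m -> maxn 19 (3 * m - 8) < second_max m.
Proof.
move=> m8; have [m13|m13] := ltnP m 13; first by move: m8 m13; do 13 (case: m => [|m] //).
rewrite second_max_large // (_ : m - 4 = (m - 13) + 9); last by lia.
by rewrite binD2 (_ : 'C(9, 2) = 36) //; lia.
Qed.

Lemma second_max_comet m : 8 <= m -> 4 + 'C(m - 4, 2) <= second_max m ?= iff (13 <= m).
Proof.
move=> m8; have [m13|m13] := ltnP m 13.
  by split; move: m8 m13; do 13 (case: m => [|m] //).
by rewrite second_max_large //; split; rewrite ?leqnn ?eqxx.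
Qed.

Lemma second_lt_first m : 7 <= m -> second_max m < first_max m.
Proof.
move=> m7; have [m13|m13] := ltnP m 13; first by move: m7 m13; do 13 (case: m => [|m] //).
rewrite second_max_large // first_max_large; last by lia.
rewrite (_ : m - 1 = (m - 4) + 3); last by lia.
by rewrite binD2 (_ : 'C(3, 2) = 3) //; lia.
Qed.

(** [maxn 4 (m - 6)] bounds the edges meeting the spine of a fork. At m = 10 both sides equal 24, so
    the small orders need separate arguments. *)
Lemma second_max_step2 m : 11 <= m -> second_max (m - 2) + maxn 4 (m - 6) < second_max m.
Proof.
move=> m8; have [m17|m17] := ltnP m 17; first by move: m8 m17; do 17 (case: m => [|m] //).
rewrite !second_max_large; try lia.
rewrite (_ : m - 4 = (m - 2 - 4) + 2); last by lia.
by rewrite binD2 (_ : 'C(2, 2) = 1) //; lia.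
Qed.

(** For a fork with t pages, no side edges, and all remaining edges through d, which then avoid the
    other pages. *)
Lemma second_max_pages m t : 8 <= m -> 3 <= t <= m - 6 -> t + 'C(m - 2 - t, 2) < second_max m.
Proof.
move=> m8 /andP[t3 tm]; have := (second_max_comet m8).1.
rewrite (_ : m - 4 = (m - 2 - t) + (t - 2)); last by lia.
rewrite binD2; have : 4 * (t - 2) <= (m - 2 - t) * (t - 2) by rewrite leq_mul //; lia.
lia.
Qed.

(** For two disjoint edges that each contain a page: at most m - 2 pages and 2 side edges, the
    neighbours of each edge, and the edges on the other m - 8 vertices. *)
Lemma second_max_far_good m : 8 <= m ->
  m + 2 * maxn 4 (m - 7) + first_max (m - 8) < second_max m.
Proof.
move=> m8; have [m17|m17] := ltnP m 17; first by move: m8 m17; do 17 (case: m => [|m] //).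
rewrite second_max_large ?first_max_large; try lia.
rewrite (_ : m - 4 = (m - 8 - 1) + 5); last by lia.
by rewrite binD2 (_ : 'C(5, 2) = 10) //; lia.
Qed.

(** One page outside D: 10 stands for at most 1 + 3 pages and 6 side edges. *)
Lemma second_max_far1 m : 7 <= m -> 10 + maxn 4 (m - 4) + first_max (m - 6) < second_max m.
Proof.
move=> m8; have [m17|m17] := ltnP m 17; first by move: m8 m17; do 17 (case: m => [|m] //).
rewrite second_max_large ?first_max_large; try lia.
rewrite (_ : m - 4 = (m - 6 - 1) + 3); last by lia.
by rewrite binD2 (_ : 'C(3, 2) = 3) //; lia.
Qed.

(** Here t is the number of pages outside D; together with a, b and D they are avoided by all edges
    counted by [first_max]. *)
Lemma second_max_far m t : 7 <= m -> 2 <= t <= m - 5 ->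
  t + 8 + maxn 4 (m - 4) + first_max (m - 5 - t) < second_max m.
Proof.
move=> m8 /andP[t2 tm]; have [m17|m17] := ltnP m 17.
  have /allP/(_ m) : all (fun m => (m >= 7) ==> all (fun t => (t <= m - 5) ==>
      (t + 8 + maxn 4 (m - 4) + first_max (m - 5 - t) < second_max m)) (iota 2 11)) (iota 0 17).
    by vm_compute.
  rewrite mem_iota m8 => /(_ m17)/allP/(_ t); rewrite mem_iota tm; apply; lia.
have : first_max (m - 5 - t) <= first_max (m - 7) by apply: first_max_mono; lia.
rewrite second_max_large ?(@first_max_large (m - 7)); try lia.
rewrite (_ : m - 4 = (m - 7 - 1) + 4); last by lia.
by rewrite binD2 (_ : 'C(4, 2) = 6) //; lia.
Qed.

(** A part of six vertices is excluded because K6 is a component of extremal systems: with parts 6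
    and 3, for example, both sides equal 21. *)
Lemma second_max_split a b : 3 <= a -> 3 <= b -> 7 <= a + b -> a != 6 -> b != 6 ->
  first_max a + first_max b < second_max (a + b).
Proof.
wlog ab : a b / a <= b.
  move=> h a3 b3 ab7 a6 b6; have [|/ltnW] := leqP a b => ab; first exact: h.
  by rewrite addnC [a + b]addnC; apply: h => //; rewrite addnC.
move=> a3 b3 ab7 a6 b6; have [b15|b15] := ltnP b 15.
  have /allP/(_ b) : all (fun b => all (fun a => [&& 3 <= a, a <= b, 7 <= a + b, a != 6 & b != 6] ==>
      (first_max a + first_max b < second_max (a + b))) (iota 0 15)) (iota 0 15).
    by vm_compute.
  rewrite mem_iota => /(_ b15)/allP/(_ a); rewrite mem_iota a3 ab ab7 a6 b6.
  by apply; lia.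
rewrite second_max_large ?(@first_max_large b); try lia.
have [a8|a8] := ltnP a 8.
  rewrite (_ : a + b - 4 = (b - 1) + (a - 3)); last by lia.
  have : [|| a == 3, a == 4, a == 5 | a == 7] by lia.
  have [f3 f4 f5 f7] : [/\ first_max 3 = 1, first_max 4 = 4, first_max 5 = 10 & first_max 7 = 20].
    by [].
  by rewrite binD2; case/or4P => /eqP->; rewrite ?f3 ?f4 ?f5 ?f7; lia.
rewrite first_max_large //.
rewrite (_ : a + b - 4 = (b - 3) + (a - 1)); last by lia.
rewrite (_ : b - 1 = (b - 3) + 2); last by lia.
rewrite !binD2 (_ : 'C(2, 2) = 1) //.
have : (b - 3) * 2 <= (b - 3) * (a - 1) by rewrite leq_mul //; lia.
lia.
Qed.

Lemma second_max_split6 b : 8 <= b -> 20 + first_max b < second_max (6 + b).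
Proof.
move=> b8; rewrite second_max_large ?first_max_large; try lia.
rewrite (_ : 6 + b - 4 = (b - 1) + 3); last by lia.
by rewrite binD2 (_ : 'C(3, 2) = 3) //; lia.
Qed.

(** * The candidate extremal systems and their sizes *)

Section Extremal.
Variable V : finType.
Implicit Types (a b c d u v w x y z : V) (p q r s e f g h S A B D T X : {set V})
  (G H F : {set {set V}}).

Definition full_star d X : {set {set V}} := [set e in triples X | d \in e].

Definition comet_on d A X := triples A :|: full_star d (d |: (X :\: A)).

(* For seven vertices the first alternative describes the subsystems of the first Turan family
   instead: the members of Ex^(2) are stars there. *)
Definition extremal2 F X :=
  [\/ #|X| = 7 /\ exists A, [/\ A \subset X, #|A| = 6 & F \subset triples A],
      8 <= #|X| <= 12 /\
        exists A, [/\ A \subset X, #|A| = 6 & F = triples A :|: triples (X :\: A)],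
      #|X| = 13 /\ exists A B, [/\ A \subset X, B \subset X, [disjoint A & B],
        #|A| = 6 /\ #|B| = 6 & F = triples A :|: triples B] |
      13 <= #|X| /\ exists d A, [/\ d \in A, A \subset X, #|A| = 4 & F = comet_on d A X]].

Definition classified F X :=
  [\/ #|F| < second_max #|X|, exists x, forall e, e \in F -> x \in e | extremal2 F X].

Lemma link_full_star d X : link d (full_star d X) \subset pairs (X :\ d).
Proof.
apply: (@link_pairs _ _ _ X) => [|e|e u]; rewrite ?inE.
- by apply/subsetP => e; rewrite inE => /andP[].
- by case/andP.
- by move=> /andP[/andP[/subsetP eX _] _] ue ud; rewrite ud eX.
Qed.

Lemma card_full_star d X : d \in X -> #|full_star d X| = 'C(#|X| - 1, 2).
Proof.
move=> dX; have -> : #|X| - 1 = #|X :\ d| by have := cardsD1 d X; rewrite dX; lia.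
rewrite -card_pairs -(card_link (x := d)); last by move=> e; rewrite inE => /andP[].
apply: eq_card => p; apply/idP/idP => [|pX]; first exact: (subsetP (link_full_star d X)).
have [/subsetP sp p2] := pairsP pX.
have dp : d \notin p by apply/negP => /sp; rewrite !inE eqxx.
apply/imsetP; exists (d |: p); last by rewrite setU1K.
rewrite !inE eqxx cardsU1 dp p2 !andbT; apply/subsetP => z.
by rewrite !inE => /orP[/eqP->//|/sp]; rewrite !inE => /andP[].
Qed.

Lemma star_le F X d : F \subset triples X -> (forall e, e \in F -> d \in e) ->
  #|F| <= 'C(#|X| - 1, 2).
Proof.
move=> sF dF; have [->|/set0Pn[e0 e0F]] := eqVneq F set0; first by rewrite cards0.
have [/subsetP eX _] := tripleP sF e0F; have dX := eX _ (dF _ e0F).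
rewrite -(card_full_star dX); apply: subset_leq_card; apply/subsetP => e eF.
by rewrite inE (subsetP sF _ eF) dF.
Qed.

Lemma disjoint_triples A B : #|A :&: B| < 3 -> [disjoint triples A & triples B].
Proof.
move=> AB; rewrite -setI_eq0; apply/eqP/setP => e; rewrite !inE.
apply: contraTF AB => /andP[/andP[eA /eqP e3] /andP[eB _]].
by rewrite -leqNgt -e3; apply: subset_leq_card; rewrite subsetI eA.
Qed.

Lemma card_comet_on d A X : d \in A -> A \subset X -> #|A| = 4 ->
  #|comet_on d A X| = 4 + 'C(#|X| - 4, 2).
Proof.
move=> dA AX A4; rewrite cardsU card_triples A4 (_ : 'C(4, 3) = 4) //.
rewrite card_full_star ?inE ?eqxx // cardsU1 !inE dA /= cardsD (setIidPr AX) A4.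
rewrite (_ : _ :&: _ = set0) ?cards0; first by rewrite subn0; congr (_ + 'C(_, _)); lia.
apply/eqP; rewrite setI_eq0.
rewrite disjoint_subset; apply/subsetP => e; rewrite !inE => /andP[/subsetP eA /eqP e3].
apply/negP => /andP[/andP[/subsetP eX _] de].
have [y [z [ee dy dz yz]]] := triple_pick2 e3 de.
have ye : y \in e by rewrite ee !inE eqxx orbT.
by have := eX _ ye; rewrite !inE eq_sym (negbTE dy) eA.
Qed.

Lemma card_extremal2 F X : 8 <= #|X| -> extremal2 F X -> #|F| = second_max #|X|.
Proof.
move=> X8 [[e _]|[/andP[_ X12] [A [AX A6 ->]]]|[X13 [A [B [_ _ dAB [A6 B6] ->]]]]|[X13 [d [A [dA AX A4 ->]]]]].
- by rewrite e in X8.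
- rewrite cardsU !card_triples cardsD (setIidPr AX) A6.
  have : [disjoint triples A & triples (X :\: A)].
    by apply: disjoint_triples; rewrite setIDA setIC -setIDA setDv setI0 cards0.
  rewrite -setI_eq0 => /eqP->; rewrite cards0 subn0 /second_max X12 ifN; last by lia.
  by rewrite (_ : 'C(6, 3) = 20).
- rewrite cardsU !card_triples A6 B6 X13.
  have : [disjoint triples A & triples B].
    by apply: disjoint_triples; move: dAB; rewrite -setI_eq0 => /eqP->; rewrite cards0.
  by rewrite -setI_eq0 => /eqP->; rewrite cards0.
- by rewrite card_comet_on // second_max_large.
Qed.

Lemma classified_le F X : F \subset triples X -> 7 <= #|X| -> classified F X ->
  #|F| <= first_max #|X|.
Proof.
move=> sF X7; have [X8|] := ltnP 7 #|X|; last first.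
  move=> X7'; have eX : #|X| = 7 by lia.
  rewrite eX (_ : first_max 7 = 20) // => -[|[x hx]|[[_ [A [AX A6 FA]]]|[]|[]|[]]]; rewrite ?eX //.
  - by rewrite (_ : second_max 7 = 15) //; lia.
  - by have := star_le sF hx; rewrite eX (_ : 'C(_, _) = 15) //; lia.
  - by have := subset_leq_card FA; rewrite card_triples A6.
case=> [h|[x hx]|h].
- exact: ltnW (ltn_trans h (second_lt_first X7)).
- by rewrite first_max_large // (star_le sF hx).
- by rewrite (card_extremal2 X8 h) ltnW ?second_lt_first.
Qed.

End Extremal.

(** * Forked systems *)

Section Forked.
Variable V : finType.
Implicit Types (a b c d u v w x y z : V) (p q r s e f g h S A B D T X Y : {set V})
  (G H F : {set {set V}}).

Lemma rest_sub H S a b : H \subset triples S -> rest a b H \subset triples (S :\ a :\ b).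
Proof.
move=> sH; apply/subsetP => e /restP[eH ae be]; have [/subsetP eS e3] := tripleP sH eH.
rewrite inE e3 eqxx andbT; apply/subsetP => z ze; rewrite !inE (eS _ ze) andbT.
by apply/andP; split; [apply: contraNneq be|apply: contraNneq ae] => <-.
Qed.

Lemma rest_subset a b H : rest a b H \subset H.
Proof. by apply/subsetP => e /restP[]. Qed.

(** Few edges meet the spine ab, so the edges avoiding it must be close to extremal on |S| - 2
    vertices. If they form a star, its centre is d and H lies in a comet or is small; otherwise the
    induction applies to them. *)
Lemma forked_classified H S : H \subset triples S -> pfree H -> forked H ->
  (forall X F, #|X| < #|S| -> 7 <= #|X| -> F \subset triples X -> pfree F ->
    classified F X) -> classified H S.
Proof.
move=> sH pH [a [b [c [d [D [D' [[cT dT] [DR D'R] ed /andP[cD cD']]]]]]]] IH.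
have [ab ca cb [aS bS cS]] := pagesP sH cT; have [_ da db [_ _ dS]] := pagesP sH dT.
have [[DH aD bD] [D'H aD' bD']] := (restP DR, restP D'R).
have [[DS D3] [D'S D'3]] := (tripleP sH DH, tripleP sH D'H).
have [dD dD'] : d \in D /\ d \in D' by apply/andP; rewrite -in_setI ed inE.
have uniq_d z : z \in D -> z \in D' -> z = d.
  by move=> zD zD'; apply/set1P; rewrite -ed inE zD.
have cd : c != d by apply: contraNneq cD => ->.
have abcH : [set a; b; c] \in H by rewrite inE in cT.
have abdH : [set a; b; d] \in H by rewrite inE in dT.
set T := pages a b H; set R := S :\ a :\ b.
have cR : #|R| = #|S| - 2 by rewrite cardsD2.
have sR : rest a b H \subset triples R := rest_sub a b sH.
pose Y := (D :|: D') :\ d.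
have cY : #|Y| = 4.
  have cU : #|D :|: D'| = 5 by rewrite cardsU ed D3 D'3 cards1.
  by rewrite /Y cardsD1_in ?cU // inE dD.
(* A page x in D other than d would make D join abx to D'. *)
have TY x : x \in T -> x \in Y -> False.
  have key E E' : E \in rest a b H -> E' \in rest a b H -> d \in E -> d \in E' ->
      (forall z, z \in E -> z \in E' -> z = d) -> x \in T -> x \in E -> x = d.
    move=> ER E'R dE dE' ud xT xE; apply/eqP; apply: contraT => xd; exfalso.
    have [_ xa xb _] := pagesP sH xT.
    have [[EH aE bE] [E'H aE' bE']] := (restP ER, restP E'R).
    have xH : [set a; b; x] \in H by rewrite inE in xT.
    have xE' : x \notin E' by apply: contraNN xd => xE'; rewrite (ud x).
    by apply: (pfree_meet (x := x) (y := d) pH xH E'H EH); try apply: ud; mem_solve.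
  move=> xT; rewrite !inE => /andP[xd /orP[] xE]; move: xd.
    by rewrite (key D D') ?eqxx.
  by rewrite (key D' D) ?eqxx // => z h1 h2; apply: uniq_d.
have cYout : #|[set a; b] :|: Y| = 6.
  rewrite cardsU cards2 ab cY (_ : _ :&: _ = set0) ?cards0 //.
  by apply/eqP; rewrite -subset0; apply/subsetP => z; rewrite !inE => /andP[/orP[]/eqP->];
    rewrite ?(negbTE aD) ?(negbTE bD) ?(negbTE aD') ?(negbTE bD') andbF.
have abYS : [set a; b] :|: Y \subset S.
  apply/subsetP => z; rewrite !inE => /orP[/orP[]/eqP-> //|/andP[_ /orP[]]].
    exact: (subsetP DS).
  exact: (subsetP D'S).
have cTle : #|T| <= #|S| - 6.
  have : T \subset S :\: ([set a; b] :|: Y).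
    apply/subsetP => x xT; have [_ xa xb [_ _ xS]] := pagesP sH xT.
    rewrite inE xS andbT in_setU negb_or !inE negb_or xa xb /=.
    by rewrite -[_ && _]/(_) -!in_setU -in_setD1; apply/negP => /(TY x xT).
  by move/subset_leq_card; rewrite cardsD (setIidPr abYS) cYout.
have S8 : 8 <= #|S|.
  have : [set a; b] :|: Y :|: [set c; d] \subset S.
    by rewrite subUset abYS; apply/subsetP => z; rewrite !inE => /orP[]/eqP->.
  move/subset_leq_card; rewrite cardsU cYout cards2 cd (_ : _ :&: _ = set0) ?cards0 //.
  apply/eqP; rewrite -subset0; apply/subsetP => z; rewrite !inE => /andP[+ /orP[]/eqP ez];
    rewrite ez ?eqxx /= ?orbF => h; last by rewrite (negbTE da) (negbTE db) in h.
  by rewrite (negbTE ca) (negbTE cb) (negbTE cD) (negbTE cD') andbF in h.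
(* The trace lies in both c |: D and c |: D', whose intersection is {c, d}. *)
have sideE e : e \in side a b H -> e :\ a :\ b = [set c; d].
  move=> eB; apply/eqP; rewrite eqEcard (side_card sH eB) cards2 cd andbT.
  apply/subsetP => z ze; have := subsetP (side_sub pH sH cT dT DR dD cD eB) _ ze.
  have := subsetP (side_sub pH sH cT dT D'R dD' cD' eB) _ ze.
  rewrite !inE; case: (z =P c) => //= _ zD' zD; apply/eqP; exact: uniq_d.
have side2 : #|side a b H| <= 2.
  apply: leq_trans (side_le (Q := [set [set c; d]]) _) _; last by rewrite cards1.
  by move=> e /sideE->; rewrite inE.
have xD x : x \in T -> x != d -> x \notin D.
  by move=> xT xd; apply/negP => xD; apply: (TY x xT); rewrite !inE xd xD.
(* With a third page x in the role of c, the trace {c, d} would have to lie in x |: D, which does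
   not contain c. *)
have side0 x : x \in T -> x != c -> x != d -> side a b H = set0.
  move=> xT xc xd; apply/setP => e; rewrite in_set0; apply/negP => eB.
  have := side_sub pH sH xT dT DR dD (xD _ xT xd) eB; rewrite (sideE _ eB).
  by move=> /subsetP/(_ c); rewrite !inE eqxx (eq_sym c x) (negbTE xc) (negbTE cD) => /(_ isT).
have removed : #|T| + #|side a b H| <= maxn 4 (#|S| - 6).
  have [sT|] := boolP (T \subset [set c; d]).
    by have := subset_leq_card sT; rewrite cards2 cd; card_lia.
  case/subsetPn=> x xT; rewrite !inE negb_or => /andP[xc xd].
  by rewrite (side0 x) // cards0; card_lia.
have total := card_book sH ab; rewrite -/T in total.
(* The third vertex of e is missing from D or from D'; e then joins abc to that edge at c and d. *)
have cdrest e : e \in rest a b H -> c \in e -> d \in e -> False.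
  move=> eR ce de; have [eH ae be] := restP eR; have [_ e3] := tripleP sH eH.
  have [x [ee cx dx]] := triple_pick1 e3 ce de cd.
  have xa : x != a by apply: contraNneq ae => <-; rewrite ee !inE eqxx !orbT.
  have xb : x != b by apply: contraNneq be => <-; rewrite ee !inE eqxx !orbT.
  have key E : E \in H -> a \notin E -> b \notin E -> c \notin E -> d \in E ->
      x \notin E -> False.
    move=> EH aE bE cE dE xE.
    by apply: (pfree_meet (x := c) (y := d) pH abcH EH eH); rewrite ?ee; mem_solve.
  have [xD1|xD1] := boolP (x \in D); last exact: (key D).
  apply: (key D') => //; apply/negP => xD'.
  by move: dx; rewrite (uniq_d x) ?eqxx.
have starcase : (forall e, e \in rest a b H -> d \in e) -> classified H S.
  move=> dR; have [sT|] := boolP (T \subset [set c; d]); last first.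
    case/subsetPn=> x xT; rewrite !inE negb_or => /andP[xc xd].
    have T3 : 2 < #|T|.
      have : [set c; d; x] \subset T.
        by apply/subsetP => z; rewrite !in_setU !in_set1 => /orP[/orP[]|]/eqP->; [exact: cT|exact: dT|exact: xT].
      by move/subset_leq_card; rewrite cards3 // eq_sym.
    (* The argument of [cdrest] with z in place of c. *)
    have Tout z e : z \in T -> z != d -> e \in rest a b H -> z \notin e.
      move=> zT zd eR; apply/negP => ze; have de := dR _ eR.
      have [eH ae be] := restP eR; have [_ e3] := tripleP sH eH.
      have [y [ee zy dy]] := triple_pick1 e3 ze de zd.
      have ya : y != a by apply: contraNneq ae => <-; rewrite ee !inE eqxx !orbT.
      have yb : y != b by apply: contraNneq be => <-; rewrite ee !inE eqxx !orbT.
      have [_ za zb _] := pagesP sH zT.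
      have zH : [set a; b; z] \in H by move: zT; rewrite inE.
      have key E : E \in H -> a \notin E -> b \notin E -> z \notin E -> d \in E ->
          y \notin E -> False.
        move=> EH aE bE zE dE yE.
        by apply: (pfree_meet (x := z) (y := d) pH zH EH eH); rewrite ?ee; mem_solve.
      have zD' : z \notin D'.
        by apply/negP => zD'; apply: (TY z zT); rewrite !inE zd zD' orbT.
      have [yD|yD] := boolP (y \in D); last exact: (key D DH aD bD (xD _ zT zd)).
      apply: (key D') => //; apply/negP => yD'.
      by move: dy; rewrite (uniq_d y) ?eqxx.
    have lR : #|rest a b H| <= 'C(#|S| - 2 - #|T|, 2).
      have sub : link d (rest a b H) \subset pairs (R :\: T).
        apply: (link_pairs sR dR) => e z eR ze zd.
        have [/subsetP eS _] := tripleP sR eR; rewrite inE eS // andbT.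
        by apply: contraTN ze => zT; apply: Tout zd eR.
      have := subset_leq_card sub; rewrite card_link // card_pairs cardsD cR.
      rewrite (setIidPr _) //; apply/subsetP => z zT.
      by have [_ za zb [_ _ zS]] := pagesP sH zT; rewrite !inE za zb.
    constructor 1; have := second_max_pages S8 (_ : 2 < #|T| <= #|S| - 6).
    by rewrite T3 cTle (side0 x) // cards0 addn0 in total * => /(_ isT); card_lia.
  (* Only the pages c and d remain, so every edge meeting the spine lies in A, the K4 of a comet
     with centre d. *)
  pose A := [set a; b; c; d].
  have A4 : #|A| = 4.
    by rewrite /A setUC cardsU1 cards3 // 1?eq_sym // !inE !negb_or da db eq_sym cd.
  have sub : H \subset comet_on d A S.
    apply/subsetP => e eH; have [/subsetP eS e3] := tripleP sH eH.
    rewrite in_setU; apply/orP; have [eR|eR] := boolP (e \in rest a b H).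
      right; have de := dR _ eR; have [_ ae be] := restP eR.
      rewrite !inE e3 de eqxx !andbT; apply/subsetP => z ze; rewrite !inE (eS _ ze) andbT.
      have [//|zd] := eqVneq z d; rewrite orbF !negb_or.
      apply/andP; split; first (apply/andP; split).
      - by apply: contraNneq ae => <-.
      - by apply: contraNneq be => <-.
      - by apply/eqP => zc; apply: (cdrest e eR _ de); rewrite -zc.
    left; rewrite inE e3 eqxx andbT.
    have [eB|eB] := boolP (e \in side a b H).
      have h := sideE _ eB; apply/subsetP => z ze; rewrite !inE.
      case: (eqVneq z a) => //= za; case: (eqVneq z b) => //= zb.
      have : z \in e :\ a :\ b by rewrite !inE za zb.
      by rewrite h !inE.
    have [ae be] : a \in e /\ b \in e.
      by move: eR eB; rewrite !inE eH /=; case: (a \in e); case: (b \in e).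
    have [x [ee ax bx]] := triple_pick1 e3 ae be ab.
    have : x \in [set c; d] by apply: (subsetP sT); rewrite inE -ee.
    by rewrite ee !inE => hx; apply/subsetP => z; rewrite !inE => /orP[->//|/eqP->];
      case/orP: hx => ->; rewrite ?orbT.
  have AS : A \subset S by apply/subsetP => z; rewrite !inE => /orP[/orP[/orP[]|]|]/eqP->.
  have dA : d \in A by rewrite !inE eqxx !orbT.
  have cC := card_comet_on dA AS A4; have le := subset_leq_card sub; rewrite cC in le.
  have [lt eq] := second_max_comet S8.
  have [lt'|ge] := ltnP #|H| (second_max #|S|); first by constructor 1.
  have e1 : 4 + 'C(#|S| - 4, 2) = second_max #|S| by card_lia.
  constructor 3; constructor 4; rewrite -eq e1; split; first exact/eqP.
  exists d, A; split=> //; apply/eqP.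
  by rewrite eqEcard sub cC /= e1.
(* Otherwise D or D' would join abd, at d, to e. *)
have noY e : e \in rest a b H -> d \notin e -> #|e :&: D| != 1 /\ #|e :&: D'| != 1.
  have key E : E \in rest a b H -> d \in E -> e \in rest a b H -> d \notin e -> #|e :&: E| != 1.
    move=> ER dE eR de; apply/negP => /cards1P[w ew].
    have [[EH aE bE] [eH ae be]] := (restP ER, restP eR).
    have [we wE] : w \in e /\ w \in E by apply/andP; rewrite -in_setI ew inE.
    apply: (pfree_meet (x := d) (y := w) pH abdH eH EH); try by mem_solve.
    by move=> z zE ze; apply/set1P; rewrite -ew inE ze.
  by move=> eR de; split; apply: key.
(* Y has two vertices in each of D and D', so a triple inside Y meets one of these edges exactly
   once. *)
have noYt e : e \in rest a b H -> e \subset Y -> False.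
  move=> eR eY; have [eH _ _] := restP eR; have [_ e3] := tripleP sH eH.
  have de : d \notin e by apply/negP => /(subsetP eY); rewrite !inE eqxx.
  have [n1 n2] := noY e eR de.
  have ei : (e :&: D) :&: (e :&: D') = set0.
    apply/eqP; rewrite -subset0; apply/subsetP => z; rewrite !inE.
    by move=> /andP[/andP[ze zD] /andP[_ zD']]; rewrite (uniq_d z zD zD') (negbTE de) in ze.
  have eU : (e :&: D) :|: (e :&: D') = e.
    rewrite -setIUr; apply/setIidPl; apply: subset_trans eY _; exact: subsetDl.
  have := cardsU (e :&: D) (e :&: D'); rewrite ei eU cards0 e3.
  have small (E : {set V}) : #|E| = 3 -> d \in E -> #|e :&: E| <= 2.
    move=> E3 dE; apply: leq_trans (_ : #|E :\ d| <= _); last by rewrite cardsD1_in // E3.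
    apply: subset_leq_card; apply/subsetP => z; rewrite !inE => /andP[ze ->].
    by rewrite andbT; apply: contraNneq de => <-.
  have := small D D3 dD; have := small D' D'3 dD'; card_lia.
have [/existsP[x /forallP hx]|] := boolP [exists x, forall e in rest a b H, x \in e].
  have xd : x = d by apply: uniq_d; [move: (hx D)|move: (hx D')]; rewrite ?DR ?D'R.
  by apply: starcase => e eR; move: (hx e); rewrite eR xd.
rewrite negb_exists => /forallP nostar.
have {}nostar : ~ exists x, forall e, e \in rest a b H -> x \in e.
  case=> x hx; move/negP: (nostar x); apply; apply/forallP => e.
  by apply/implyP/hx.
have Yin A : rest a b H \subset triples A -> Y \subset A.
  move=> sA; have [DA _] := tripleP sA DR; have [D'A _] := tripleP sA D'R.
  by apply: subset_trans (subsetDl _ _) _; rewrite subUset DA.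
(* Of the 20 triples of A, the four inside Y are missing. *)
have bound6 A : #|A| = 6 -> rest a b H \subset triples A ->
    #|rest a b H| <= #|triples A :\: triples Y| /\ #|triples A :\: triples Y| = 16.
  move=> A6 sA; split.
    apply: subset_leq_card; apply/subsetP => e eR; rewrite in_setD (subsetP sA _ eR) andbT.
    by apply/negP; rewrite inE => /andP[eY _]; apply: noYt eR eY.
  rewrite cardsD (setIidPr _) ?triplesS ?Yin // !card_triples A6 cY.
  by [].
constructor 1; have [S11|S11] := ltnP 10 #|S|.
  have S11' : 7 <= #|R| by rewrite cR; card_lia.
  have SR : #|R| < #|S| by rewrite cR; card_lia.
  have := second_max_step2 S11; rewrite -cR.
  have [h|//|h] := IH _ _ SR S11' sR (pfreeS (rest_subset a b H) pH); first by card_lia.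
  by have := card_extremal2 _ h; rewrite cR => /(_ ltac:(card_lia)); card_lia.
(* The tight order: the only danger is a complete K6 on R, which would contain the forbidden triples
   of Y. *)
have [e10|n10] := eqVneq #|S| 10.
  have S11' : 7 <= #|R| by rewrite cR; card_lia.
  have SR : #|R| < #|S| by rewrite cR; card_lia.
  rewrite e10 in removed cR *; rewrite (_ : second_max 10 = 24) //.
  have [|//|h] := IH _ _ SR S11' sR (pfreeS (rest_subset a b H) pH).
    by rewrite cR (_ : second_max (10 - 2) = 20) //; card_lia.
  case: h; rewrite cR => -[] // _ [A [AR A6 er]].
  have cB : #|R :\: A| = 2 by rewrite cardsD (setIidPr AR) cR A6.
  have inA e : e \in rest a b H -> e \subset A.
    rewrite er !inE => /orP[/andP[]//|/andP[/subset_leq_card]].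
    by rewrite cB => le /eqP e3; rewrite e3 in le.
  have YA : Y \subset A.
    by apply: subset_trans (subsetDl _ _) _; rewrite subUset !inA.
  have /card_gt2P[x [y [z [[xY yY zY] [xy yz zx]]]]] : 2 < #|Y| by rewrite cY.
  have eY : [set x; y; z] \subset Y by apply/subsetP => t; rewrite !in_setU !in_set1 => /orP[/orP[]|]/eqP->.
  exfalso; apply: (noYt [set x; y; z]) => //.
  by rewrite er !inE (subset_trans eY YA) cards3 // eq_sym.
have [e9|n9] := eqVneq #|S| 9.
  have S11' : 7 <= #|R| by rewrite cR e9.
  have SR : #|R| < #|S| by rewrite cR e9.
  rewrite e9 in removed cR *; rewrite (_ : second_max 9 = 21) //.
  have [|//|h] := IH _ _ SR S11' sR (pfreeS (rest_subset a b H) pH).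
    by rewrite cR (_ : second_max (9 - 2) = 15) //; card_lia.
  case: h; rewrite cR => -[] // _ [A [AR A6 er]].
  by have [l1 l2] := bound6 A A6 er; card_lia.
have e8 : #|S| = 8 by card_lia.
(* 16 + 4 would just reach [second_max 8]. One more missing triple is needed: cdx with x in D,
   excluded by [cdrest]. *)
rewrite e8 in removed cR *; rewrite (_ : second_max 8 = 20) //.
have [l1 l2] := bound6 R cR sR.
have [x xD1] : exists x, x \in D :\ d.
  by apply/set0Pn; rewrite -card_gt0 cardsD1_in // D3.
move: xD1; rewrite !inE => /andP[xd xD1].
have xc : x != c by apply: contraNneq cD => <-.
have xa : x != a by apply: contraNneq aD => <-.
have xb : x != b by apply: contraNneq bD => <-.
have cdx : [set c; d; x] \in triples R :\: triples Y.
  rewrite in_setD !in_triples cards3 ?(eq_sym _ x) // eqxx !andbT; apply/andP; split.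
    apply/negP => /subsetP/(_ c); rewrite !inE eqxx (negbTE cD) (negbTE cD') andbF.
    by move=> /(_ isT).
  by apply/subsetP => z; rewrite !inE => /orP[/orP[]|]/eqP->;
    rewrite ?cS ?dS ?(subsetP DS) // ?ca ?cb ?da ?db ?xa ?xb.
have : #|rest a b H| <= 15.
  have <- : #|(triples R :\: triples Y) :\ [set c; d; x]| = 15 by rewrite cardsD1_in // l2.
  apply: subset_leq_card; apply/subsetP => e eR; rewrite in_setD1; apply/andP; split.
    by apply/eqP => ee; apply: (cdrest e eR); rewrite ee !inE eqxx ?orbT.
  rewrite in_setD (subsetP sR _ eR) andbT.
  by apply/negP; rewrite inE => /andP[eY _]; apply: noYt eR eY.
card_lia.
Qed.

End Forked.

(** * Unforked connected systems *)

Section Unforked.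
Variable V : finType.
Implicit Types (a b c d u v w x y z : V) (p q r s e f g h S A B D E T X Y Z : {set V})
  (G H F : {set {set V}}).

Lemma side_pairs_le H S a b Z : H \subset triples S ->
  (forall e, e \in side a b H -> e :\ a :\ b \subset Z) -> #|side a b H| <= 2 * 'C(#|Z|, 2).
Proof.
move=> sH hZ; rewrite -card_pairs; apply: side_le => // e eB.
by rewrite inE hZ // (side_card sH eB).
Qed.

Lemma neighbours_two H S a b d D : pfree H -> H \subset triples S -> ~ forked H ->
  1 < #|pages a b H| -> d \in pages a b H -> d \in D -> D \in rest a b H ->
  forall e, e \in rest a b H -> meet e D -> 1 < #|e :&: D|.
Proof.
move=> pH sH nf T2 dT dD DR e eR eD.
have := unforked_meet pH sH nf T2 DR eR dT dD; rewrite setIC.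
by move: eD; rewrite /meet -setI_eq0 -cards_eq0; card_lia.
Qed.

(** Two neighbours have at least two vertices each in D, so they share one. If they shared only one,
    neither could contain the page d; but then both contain the two vertices of D other than d. *)
Lemma neighbours_pairwise H S a b d D : pfree H -> H \subset triples S -> ~ forked H ->
  1 < #|pages a b H| -> d \in pages a b H -> d \in D -> D \in rest a b H ->
  forall e f, e \in rest a b H -> f \in rest a b H -> meet e D -> meet f D ->
  1 < #|e :&: f|.
Proof.
move=> pH sH nf T2 dT dD DR e f eR fR eD fD.
have [[DH _ _] [eH _ _]] := (restP DR, restP eR); have [fH _ _] := restP fR.
have [_ D3] := tripleP sH DH.
have le := neighbours_two pH sH nf T2 dT dD DR eR eD.
have lf := neighbours_two pH sH nf T2 dT dD DR fR fD.
rewrite ltnNge; apply/negP => small.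
have sub E : E \in rest a b H -> 1 < #|E :&: D| -> d \notin E -> E :&: D = D :\ d.
  move=> _ lE dE; apply/eqP; rewrite eqEcard cardsD1_in // D3 lE andbT.
  apply/subsetP => z; rewrite !inE => /andP[zE ->]; rewrite andbT.
  by apply: contraNneq dE => <-.
have lU : #|(e :&: D) :|: (f :&: D)| <= 3.
  by rewrite -D3; apply: subset_leq_card; rewrite -setIUl subsetIr.
have lI : #|(e :&: D) :&: (f :&: D)| <= #|e :&: f|.
  by apply: subset_leq_card; apply: setISS; apply: subsetIl.
have one : #|e :&: f| = 1.
  have := cardsUI (e :&: D) (f :&: D); card_lia.
have de : d \notin e.
  by apply/negP => de; have := unforked_meet pH sH nf T2 eR fR dT de; rewrite one.
have df : d \notin f.
  by apply/negP => df; have := unforked_meet pH sH nf T2 fR eR dT df; rewrite setIC one.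
by move: lI; rewrite (sub e) // (sub f) // setIid cardsD1_in // D3 one.
Qed.

Lemma neighbours_le H S a b d D X (N : {set {set V}}) : pfree H -> H \subset triples S -> ~ forked H ->
  1 < #|pages a b H| -> d \in pages a b H -> d \in D -> D \in rest a b H ->
  N \subset triples X -> (forall e, e \in N -> e \in rest a b H /\ meet e D) ->
  #|N| <= maxn 4 (#|X| - 2).
Proof.
move=> pH sH nf T2 dT dD DR sN hN; apply: pairwise_two_le => // e f /hN[eR eD] /hN[fR fD].
exact: (neighbours_pairwise pH sH nf T2 dT dD DR).
Qed.

Definition connected H S := forall A, A \subset S -> A != set0 -> A != S ->
  exists e, [/\ e \in H, meet e A & ~~ (e \subset A)].

(* The crossing edge of the six vertices a, b, c and D cuts down the possible links of a and b. *)
Lemma side_le6 H S a b c d D : pfree H -> H \subset triples S -> ~ forked H ->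
  7 <= #|S| -> connected H S -> 1 < #|pages a b H| ->
  c \in pages a b H -> d \in pages a b H -> D \in rest a b H -> d \in D -> c \notin D ->
  #|side a b H| <= 6.
Proof.
move=> pH sH nf S7 conn T2 cT dT DR dD cD; set T := pages a b H.
have [ab ca cb [aS bS cS]] := pagesP sH cT; have [_ da db _] := pagesP sH dT.
have [DH aD bD] := restP DR; have [DS D3] := tripleP sH DH.
have cd : c != d by apply: contraNneq cD => ->.
have sidec := side_sub pH sH cT dT DR dD cD.
(* Two pages outside D can both play the role of c, which confines the traces to the three vertices
   of D. *)
have [T1|] := leqP #|T :\: D| 1; last first.
  case/card_gt1P=> y1 [y2 []]; rewrite !in_setD => /andP[y1D y1T] /andP[y2D y2T] y12.
  have := @side_pairs_le H S a b D sH; rewrite D3; apply => e eB.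
  apply/subsetP => z ze.
  have := subsetP (side_sub pH sH y1T dT DR dD y1D eB) _ ze.
  have := subsetP (side_sub pH sH y2T dT DR dD y2D eB) _ ze.
  by rewrite !inE; case: (z =P y2) => //= ->; rewrite eq_sym (negbTE y12).
have TD x : x \in T -> x \notin D -> x = c.
  move=> xT xD; apply/eqP; apply: contraT => xc.
  have : #|[set x; c]| <= #|T :\: D|.
    apply: subset_leq_card; apply/subsetP => z.
    by rewrite in_setU !in_set1 in_setD => /orP[]/eqP->; rewrite ?xD ?cD.
  by rewrite cards2 xc leqNgt ltnS T1.
(* Now all pages and all side edges lie inside U, so an edge h leaving U avoids a and b. *)
pose U := a |: (b |: (c |: D)).
have US : U \subset S by rewrite !subUset !sub1set aS bS cS.
have cU : #|U| = 6.
  by rewrite !cardsU1 !inE !negb_or (negbTE aD) (negbTE bD) (negbTE cD) ab (eq_sym a c) ca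
     (eq_sym b c) cb D3.
have U0 : U != set0 by apply/set0Pn; exists a; rewrite !inE eqxx.
have nUS : U != S by apply: contraTneq S7 => <-; rewrite cU.
have [h [hH /meetP[z0 z0h z0U] hU]] := conn U US U0 nUS; have [_ h3] := tripleP sH hH.
have TU x : x \in T -> x \in U.
  move=> xT; rewrite !inE; case xD: (x \in D); first by rewrite !orbT.
  by rewrite (TD x xT) ?xD // eqxx !orbT.
have hR : h \in rest a b H.
  rewrite inE hH /=; apply: contraNT hU => hab.
  have [ah|ah] := boolP (a \in h); have [bh|bh] := boolP (b \in h).
  - have [x [ee ax bx]] := triple_pick1 h3 ah bh ab.
    have : x \in U by apply: TU; rewrite inE -ee.
    move=> xU; rewrite ee; apply/subsetP => z; rewrite in_setU in_setU !in_set1.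
    by move=> /orP[/orP[]|]/eqP-> //; rewrite !inE eqxx ?orbT.
  - have hB : h \in side a b H by rewrite inE hH ah (negbTE bh).
    apply/subsetP => z zh; have := subsetP (sidec _ hB) z; rewrite !inE zh.
    by case: (z == a) => //; case: (z == b) => //= /(_ isT).
  - have hB : h \in side a b H by rewrite inE hH bh (negbTE ah).
    apply/subsetP => z zh; have := subsetP (sidec _ hB) z; rewrite !inE zh.
    by case: (z == a) => //; case: (z == b) => //= /(_ isT).
  - by rewrite ah bh in hab.
have [_ ah bh] := restP hR.
(* If h misses D it contains c; with h in the role of D and c, d exchanged, the traces lie in both c
   |: D and d |: h. *)
have [mhD|nhD] := boolP (meet h D); last first.
  have ch : c \in h.
    move: z0U; rewrite !inE => /or4P[/eqP e0|/eqP e0|/eqP<- //|z0D].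
    - by rewrite -e0 z0h in ah.
    - by rewrite -e0 z0h in bh.
    - by case/negP: nhD; apply/meetP; exists z0.
  have dh : d \notin h by apply: contra nhD => dh; apply/meetP; exists d.
  have c2 : #|[set c; d]| = 2 by rewrite cards2 cd.
  have := @side_pairs_le H S a b [set c; d] sH; rewrite c2 => le2.
  apply: leq_trans (le2 _) _ => // e eB; apply/subsetP => z ze.
  have := subsetP (sidec _ eB) _ ze.
  have := subsetP (side_sub pH sH dT cT hR ch dh eB) _ ze.
  rewrite !inE; case: (z == d); rewrite ?orbT //= orbF => zh.
  case: (z == c) => //= zD; case/negP: nhD; by apply/meetP; exists z.
have two := neighbours_two pH sH nf T2 dT dD DR hR mhD.
have lhD : #|h :&: D| = 2.
  apply/eqP; rewrite eqn_leq two andbT -ltnS -D3 ltnNge; apply/negP => le.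
  have e1 : h :&: D = D by apply/eqP; rewrite eqEcard subsetIr.
  have e2 : h = D.
    by apply/esym/eqP; rewrite eqEcard h3 D3 leqnn andbT -e1 subsetIl.
  by move/negP: hU; apply; rewrite e2; apply/subsetP => z zD; rewrite !inE zD !orbT.
have ch : c \notin h.
  apply/negP => ch; move/negP: hU; apply.
  have e1 : c |: (h :&: D) = h.
    apply/eqP; rewrite eqEcard cardsU1 inE (negbTE cD) andbF lhD h3 andbT.
    by rewrite subUset sub1set ch subsetIl.
  rewrite -e1 subUset sub1set; apply/andP; split; first by rewrite !inE eqxx !orbT.
  by apply/subsetP => z; rewrite !inE => /andP[_ ->]; rewrite !orbT.
have [/existsP[x /andP[xT xh]]|noT] := boolP [exists x, (x \in T) && (x \in h)].
  have c3 : #|c |: (h :&: D)| = 3 by rewrite cardsU1 inE (negbTE cD) andbF lhD.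
  have := @side_pairs_le H S a b (c |: (h :&: D)) sH; rewrite c3; apply => e eB.
  apply/subsetP => z ze; have := subsetP (sidec _ eB) _ ze.
  have := subsetP (side_sub pH sH cT xT hR xh ch eB) _ ze.
  by rewrite !inE; case: (z == c) => //= -> ->.
have {}noT x : x \in T -> x \notin h.
  move=> xT; apply/negP => xh; move/negP: noT; apply; apply/existsP; exists x.
  by rewrite xh andbT; exact: xT.
have dh := noT d dT.
have abT x : x \in T -> [set a; b; x] \in H by rewrite inE.
(* No page lies in h. A side edge whose trace has exactly one vertex in h would join h to a page
   edge avoiding its other trace vertex. So the trace lies inside h, or misses h and is confined to
   c and the single vertex d of D outside h. *)
have split2 e : e \in side a b H -> e :\ a :\ b \in [set h :&: D; [set c; d]].
  move=> eB; have e2 := side_card sH eB; have sc := sidec _ eB.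
  have eH : e \in H by move: eB; rewrite inE => /andP[].
  have [_ e3] := tripleP sH eH.
  have key a' b' x y : a' \in e -> b' \notin e -> a' != b' -> a' \notin h -> b' \notin h ->
      (forall t, t \in T -> [set a'; b'; t] \in H /\ t != b') ->
      e = [set a'; x; y] -> x \in h -> y \notin h -> False.
    move=> a'e b'e a'b' a'h b'h Th ee xh yh.
    have xe : x \in e by rewrite ee !inE eqxx orbT.
    have ye : y \in e by rewrite ee !inE eqxx orbT.
    have a'x : x != a' by apply: contraTneq xh => ->.
    have b'x : x != b' by apply: contraTneq xh => ->.
    have b'y : y != b' by apply: contraNneq b'e => <-.
    have use t : t \in T -> t != y -> False.
      move=> tT ty; have [tH tb] := Th t tT; have th := noT t tT.
      have tx : t != x by apply: contraNneq th => ->.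
      by apply: (pfree_meet (x := a') (y := x) pH tH hH eH); rewrite ?ee; mem_solve.
    by have [yc|yc] := eqVneq c y; [apply: (use d dT); rewrite -yc eq_sym | apply: (use c cT)].
  have dich : (e :\ a :\ b \subset h) \/ [disjoint e :\ a :\ b & h].
    have [x [y [epy xy]]] := pair_pick e2.
    have [xe ye] : x \in e :\ a :\ b /\ y \in e :\ a :\ b by rewrite epy !inE !eqxx orbT.
    move: (xe) (ye); rewrite !inE => /and3P[xb xa xe'] /and3P[yb ya ye'].
    have nokey x' y' : x' \in e -> y' \in e -> x' != y' -> x' != a -> x' != b ->
        y' != a -> y' != b -> x' \in h -> y' \notin h -> False.
      move=> x'e y'e x'y' x'a x'b y'a y'b x'h y'h.
      move: eB; rewrite inE => /andP[_]; case ae: (a \in e); case be: (b \in e) => // _.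
        apply: (key a b x' y') => //; rewrite ?be //.
          by move=> t tT; split; [exact: abT | by have [] := pagesP sH tT].
        by apply: triple_eq => //; rewrite eq_sym.
      apply: (key b a x' y') => //; rewrite ?ae 1?eq_sym //.
        by move=> t tT; split; [rewrite (setUC [set b]); exact: abT | by have [] := pagesP sH tT].
      by apply: triple_eq => //; rewrite eq_sym.
    have [xh|xh] := boolP (x \in h); have [yh|yh] := boolP (y \in h).
    - by left; rewrite epy; apply/subsetP => t; rewrite !inE => /orP[]/eqP->.
    - by exfalso; apply: (nokey x y).
    - by exfalso; apply: (nokey y x) => //; rewrite eq_sym.
    - right; rewrite epy disjoint_subset; apply/subsetP => t; rewrite !inE.
      by move=> /orP[]/eqP->.
  rewrite !inE; case: dich => hd; apply/orP; [left|right].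
    rewrite eqEcard e2 lhD leqnn andbT; apply/subsetP => z ze.
    have zh := subsetP hd _ ze; have := subsetP sc _ ze; rewrite !inE zh.
    by case: (z =P c) => // zc; rewrite zc (negbTE ch) in zh.
  rewrite eqEcard e2 cards2 cd leqnn andbT; apply/subsetP => z ze.
  have zh := disjointFr hd ze; have := subsetP sc _ ze; rewrite !inE.
  case: (z == c) => //= zD; apply: contraT => zd.
  have : [set d; z] \subset D :\: h.
    by apply/subsetP => t; rewrite !inE => /orP[]/eqP->; rewrite ?dh ?zh.
  move/subset_leq_card; rewrite cards2 eq_sym zd cardsD setIC lhD D3.
  by [].
apply: leq_trans (side_le split2) _.
have : #|[set h :&: D; [set c; d]]| <= 2 by rewrite cards2; case: (_ != _).
by move=> le; rewrite (leq_trans (leq_mul (leqnn 2) le)).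
Qed.


(** The edges avoiding a and b split into the neighbours N of D, linear in number, and the edges Fr
    disjoint from D. If some edge of Fr contains a page, it has few neighbours as well; if none
    does, Fr avoids all pages. *)
Lemma unforked_small H S a b c d D : pfree H -> H \subset triples S -> ~ forked H ->
  7 <= #|S| -> connected H S -> c \in pages a b H -> d \in pages a b H ->
  D \in rest a b H -> d \in D -> c \notin D ->
  (forall X F, #|X| < #|S| -> F \subset triples X -> pfree F -> #|F| <= first_max #|X|) ->
  #|H| < second_max #|S|.
Proof.
move=> pH sH nf S7 conn cT dT DR dD cD IH.
have [ab ca cb [aS bS cS]] := pagesP sH cT; have [_ da db _] := pagesP sH dT.
have [DH aD bD] := restP DR; have [DS D3] := tripleP sH DH.
have cd : c != d by apply: contraNneq cD => ->.
have T2 : 1 < #|pages a b H| by apply/card_gt1P; exists c, d.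
have side6 := side_le6 pH sH nf S7 conn T2 cT dT DR dD cD.
have total := card_book sH ab.
set R := S :\ a :\ b.
have cR : #|R| = #|S| - 2 by rewrite cardsD2.
have sR : rest a b H \subset triples R := rest_sub a b sH.
have TR : pages a b H \subset R.
  apply/subsetP => x /(pagesP sH)[_ xa xb [_ _ xS]].
  by rewrite in_setD1 xb in_setD1 xa.
have DR' : D \subset R by have [] := tripleP sR DR.
have cRD : #|R :\: D| = #|S| - 5.
  by rewrite cardsD (setIidPr DR') D3 cR; card_lia.
have cTT := cardsID D (pages a b H).
have cTR := subset_leq_card TR.
pose N := [set e in rest a b H | meet e D].
pose Fr := [set e in rest a b H | ~~ meet e D].
have NR : N \subset rest a b H by apply/subsetP => e; rewrite inE => /andP[].
have FrR : Fr \subset rest a b H by apply/subsetP => e; rewrite inE => /andP[].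
have hN e : e \in N -> e \in rest a b H /\ meet e D by rewrite inE => /andP[].
have FrP e : e \in Fr -> e \in rest a b H /\ ~~ meet e D by rewrite in_set => /andP[].
have restle : #|rest a b H| <= #|N| + #|Fr|.
  apply: card_leU; apply/subsetP => e eR.
  by rewrite in_setU in_set [X in _ || X]in_set eR; case: (meet e D).
have subT (F : {set {set V}}) (X : {set V}) : F \subset rest a b H ->
    (forall e z, e \in F -> z \in e -> z \in X) -> F \subset triples X.
  move=> FR FX; apply/subsetP => e eF; rewrite inE.
  have [_ ->] := tripleP sR (subsetP FR _ eF); rewrite andbT.
  by apply/subsetP => z; apply: FX.
have inR e z : e \in rest a b H -> z \in e -> z \in R.
  by move=> eR; have [/subsetP eR' _] := tripleP sR eR; apply: eR'.
have nmeet e f z : ~~ meet e f -> z \in e -> z \notin f.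
  by move=> nm ze; apply: contra nm => zf; apply/meetP; exists z.
have pF (F : {set {set V}}) : F \subset rest a b H -> pfree F.
  by move=> FR; apply: pfreeS (subset_trans FR (rest_subset a b H)) pH.
have [/existsP[G /and3P[GR nGD /existsP[z /andP[zT zG]]]]|noG] :=
    boolP [exists G, [&& G \in rest a b H, ~~ meet G D &
      [exists z, (z \in pages a b H) && (z \in G)]]].
  have zD := nmeet _ _ _ nGD zG.
  have dG : d \notin G by apply: contra nGD => dG; apply/meetP; exists d.
  have [GH aG bG] := restP GR; have [GS G3] := tripleP sH GH.
  have zd : z != d by apply: contraNneq zD => ->.
  have side2 : #|side a b H| <= 2.
    have := @side_pairs_le H S a b [set z; d] sH; rewrite cards2 zd; apply => e eB.
    apply/subsetP => y ye.
    have := subsetP (side_sub pH sH zT dT DR dD zD eB) _ ye.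
    have := subsetP (side_sub pH sH dT zT GR zG dG eB) _ ye.
    rewrite !inE; case: (y == d); rewrite ?orbT //= orbF => yG.
    by rewrite (negbTE (nmeet _ _ _ nGD yG)) orbF.
  have GR' : G \subset R by have [] := tripleP sR GR.
  have cRG : #|R :\: G| = #|S| - 5.
    by rewrite cardsD (setIidPr GR') G3 cR; card_lia.
  have GRD : G \subset R :\: D.
    by apply/subsetP => y yG; rewrite inE (nmeet _ _ _ nGD yG) (subsetP GR').
  have cRDG : #|R :\: D :\: G| = #|S| - 8.
    by rewrite cardsD (setIidPr GRD) G3 cRD; card_lia.
  have S8 : 8 <= #|S|.
    by have := subset_leq_card GRD; rewrite G3 cRD; card_lia.
  (* A neighbour of D has two vertices in D; if it met G it would have two there as well, four in
     all. *)
  have lN : #|N| <= maxn 4 (#|R :\: G| - 2).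
    apply: (neighbours_le pH sH nf T2 dT dD DR _ hN); apply: (subT _ _ NR) => e y eN ye.
    have [eR meD] := hN _ eN; rewrite inE (inR e y eR ye) andbT.
    apply/negP => yG.
    have n1 := unforked_meet pH sH nf T2 GR eR zT zG.
    have n2 := neighbours_two pH sH nf T2 dT dD DR eR meD.
    have [_ e3] := tripleP sR eR.
    have : #|e :&: D| + #|e :&: G| <= #|e|.
      rewrite -cardsUI (_ : _ :&: _ :&: _ = set0) ?cards0 ?addn0.
        by apply: subset_leq_card; rewrite -setIUr subsetIl.
      apply/eqP; rewrite -subset0; apply/subsetP => x; rewrite !inE.
      by move=> /andP[/andP[_ xD] /andP[_ xG]]; move: (nmeet _ _ _ nGD xG); rewrite xD.
    have : 0 < #|e :&: G| by apply/card_gt0P; exists y; rewrite inE ye.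
    by rewrite setIC in n1; card_lia.
  pose N2 := [set e in Fr | meet e G]; pose F2 := [set e in Fr | ~~ meet e G].
  have N2R : N2 \subset rest a b H.
    by apply: subset_trans FrR; apply/subsetP => e; rewrite inE => /andP[].
  have F2R : F2 \subset rest a b H.
    by apply: subset_trans FrR; apply/subsetP => e; rewrite inE => /andP[].
  have lFr : #|Fr| <= #|N2| + #|F2|.
    apply: card_leU; apply/subsetP => e eF.
    by rewrite in_setU in_set [X in _ || X]in_set eF; case: (meet e G).
  have lN2 : #|N2| <= maxn 4 (#|R :\: D| - 2).
    apply: (neighbours_le pH sH nf T2 zT zG GR) => [|e eN].
      apply: (subT _ _ N2R) => e y; rewrite in_set => /andP[/FrP[eR nm] _] ye.
      by rewrite in_setD (nmeet _ _ _ nm ye) (inR _ _ eR ye).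
    by split; [exact: (subsetP N2R)|move: eN; rewrite in_set => /andP[]].
  have lF2 : #|F2| <= first_max #|R :\: D :\: G|.
    apply: IH (pF _ F2R); first by rewrite cRDG; card_lia.
    apply: (subT _ _ F2R) => e y; rewrite in_set => /andP[/FrP[eR nm] nm'] ye.
    by rewrite in_setD (nmeet _ _ _ nm' ye) in_setD (nmeet _ _ _ nm ye) (inR _ _ eR ye).
  have := second_max_far_good S8; rewrite cRDG in lF2; rewrite cRG in lN; rewrite cRD in lN2.
  rewrite -/R in cTR; rewrite cR in cTR; card_lia.
have {}noG e z : e \in Fr -> z \in pages a b H -> z \notin e.
  move=> /FrP[eR nm] zT; apply/negP => ze; move/negP: noG; apply.
  by apply/existsP; exists e; rewrite eR nm; apply/existsP; exists z; rewrite zT.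
have TDRD : pages a b H :\: D \subset R :\: D by apply: setSD.
have lT' := subset_leq_card TDRD; rewrite cRD in lT'.
have cX : #|R :\: D :\: (pages a b H :\: D)| = #|S| - 5 - #|pages a b H :\: D|.
  by rewrite cardsD (setIidPr TDRD) cRD.
have lFr : #|Fr| <= first_max #|R :\: D :\: (pages a b H :\: D)|.
  apply: IH (pF _ FrR); first by rewrite cX; card_lia.
  apply: (subT _ _ FrR) => e y eF ye; have [eR nm] := FrP _ eF.
  rewrite in_setD [X in _ && X]in_setD (nmeet _ _ _ nm ye) (inR _ _ eR ye) !andbT.
  by apply/negP; rewrite in_setD => /andP[_ yT]; move: (noG _ _ eF yT); rewrite ye.
rewrite cX in lFr.
have lN : #|N| <= maxn 4 (#|R| - 2).
  by apply: (neighbours_le pH sH nf T2 dT dD DR (subset_trans NR sR) hN).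
rewrite cR in lN.
have T'1 : 0 < #|pages a b H :\: D|.
  by apply/card_gt0P; exists c; rewrite in_setD cD.
have TD3 : #|pages a b H :&: D| <= 3.
  by rewrite -D3; apply: subset_leq_card; apply: subsetIr.
have [e1|ne1] := eqVneq #|pages a b H :\: D| 1.
  rewrite e1 in lFr cTT; have := second_max_far1 S7.
  by rewrite (_ : #|S| - 6 = #|S| - 5 - 1); [card_lia|rewrite -subnDA].
have T'2 : 1 < #|pages a b H :\: D| by card_lia.
(* With at most two pages in D the bound 6 on the side edges is enough. Only three pages in D
   require a saving. *)
suff : #|pages a b H :&: D| + #|side a b H| + #|N| <= 8 + maxn 4 (#|S| - 4).
  have := @second_max_far #|S| #|pages a b H :\: D| S7; rewrite T'2 lT' => /(_ isT).
  card_lia.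
have [TD2|TD2] := leqP #|pages a b H :&: D| 2; first by card_lia.
have DT : D \subset pages a b H.
  apply/setIidPr/eqP; rewrite eqEcard subsetIr D3; card_lia.
have [ND|] := boolP (N \subset [set D]).
  by have := subset_leq_card ND; rewrite cards1; card_lia.
case/subsetPn=> E EN; rewrite in_set1 => ED; have [ER mED] := hN _ EN.
have [_ E3] := tripleP sR ER.
have two := neighbours_two pH sH nf T2 dT dD DR ER mED.
have cED : #|E :&: D| = 2.
  apply/eqP; rewrite eqn_leq two andbT -ltnS -D3 ltnNge; apply/negP => le.
  have e1 : E :&: D = D by apply/eqP; rewrite eqEcard subsetIr.
  by move/eqP: ED; apply; apply/esym/eqP; rewrite eqEcard D3 E3 leqnn andbT -e1 subsetIl.
have /card_gt0P[x] : 0 < #|D :\: E| by rewrite cardsD setIC cED D3.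
rewrite in_setD => /andP[xE xD]; have xT := subsetP DT _ xD.
have /card_gt0P[w] : 0 < #|E :&: D| by rewrite cED.
rewrite in_setI => /andP[wE wD]; have wT := subsetP DT _ wD.
have : 0 < #|(pages a b H :\: D) :\: (E :\: D)|.
  have : #|(pages a b H :\: D) :&: (E :\: D)| <= #|E :\: D|.
    by apply: subset_leq_card; apply: subsetIr.
  have : #|E :\: D| = 1 by rewrite cardsD cED E3.
  by rewrite (cardsD (_ :\: _)); card_lia.
case/card_gt0P=> y; rewrite !in_setD => /andP[+ /andP[yD yT]]; rewrite yD /= => yE.
(* The pages x and y outside E confine the traces to E, and the pages y and y' outside D confine
   them to D, leaving the pair E :&: D. *)
have [y' y'T /andP[y'D yy']] : exists2 y', y' \in pages a b H & (y' \notin D) && (y != y').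
  have : 0 < #|(pages a b H :\: D) :\ y|.
    by rewrite cardsD1_in; [card_lia|rewrite in_setD yD].
  case/card_gt0P=> y'; rewrite in_setD1 in_setD => /and3P[y'y y'D y'T].
  by exists y'; rewrite // y'D eq_sym.
have : #|side a b H| <= 2.
  have := @side_pairs_le H S a b (E :&: D) sH; rewrite cED; apply => e eB.
  apply/subsetP => z ze; rewrite in_setI; apply/andP; split.
    have := subsetP (side_sub pH sH xT wT ER wE xE eB) _ ze.
    have := subsetP (side_sub pH sH yT wT ER wE yE eB) _ ze.
    rewrite !inE; case: (z \in E); rewrite ?orbF // => /eqP-> /eqP yx.
    by rewrite yx xD in yD.
  have := subsetP (side_sub pH sH yT dT DR dD yD eB) _ ze.
  have := subsetP (side_sub pH sH y'T dT DR dD y'D eB) _ ze.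
  rewrite !inE; case: (z \in D); rewrite ?orbF // => /eqP-> /eqP y'y.
  by rewrite y'y eqxx in yy'.
by move=> s2; apply: leq_trans (leq_add (leq_add TD3 s2) lN) _; card_lia.
Qed.

End Unforked.

(** * Classification *)

(** At m = 13 both sides are 40: K6 and K6 with an isolated vertex tie with the comet. *)
Lemma second_max_lt m : 9 <= m -> m != 13 -> second_max (m - 1) < second_max m.
Proof.
move=> m9 n13; have [m14|m14] := ltnP m 14.
  by move: m9 n13 m14; do 14 (case: m => [|m] //).
rewrite !second_max_large; try lia.
by rewrite (_ : m - 4 = (m - 1 - 4) + 1) ?binD2; lia.
Qed.

Section Classification.
Variable V : finType.
Implicit Types (a b c d u v w x y z : V) (p q r s e f g h S A B D E T X Y Z : {set V})
  (G H F : {set {set V}}).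

(** Finiteness makes [forked] decidable, so the case split on it is constructive. *)
Lemma forkedP H : reflect (forked H) [exists a, exists b, exists c, exists d, exists D, exists D',
  [&& c \in pages a b H, d \in pages a b H, D \in rest a b H, D' \in rest a b H,
      D :&: D' == [set d], c \notin D & c \notin D']].
Proof.
apply: (iffP existsP) => [[a]|[a [b [c [d [D [D' [[h1 h2] [h3 h4] h5 /andP[h6 h7]]]]]]]]].
  case/existsP=> b /existsP[c] /existsP[d] /existsP[D] /existsP[D'].
  case/and5P=> h1 h2 h3 h4 /and3P[/eqP h5 h6 h7].
  by exists a, b, c, d, D, D'; split; rewrite ?h6.
exists a; apply/existsP; exists b; apply/existsP; exists c; apply/existsP; exists d.
apply/existsP; exists D; apply/existsP; exists D'.
by rewrite h1 h2 h3 h4 h5 eqxx h6.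
Qed.

Lemma isolated_classified H S v : H \subset triples S -> pfree H -> 7 <= #|S| ->
  v \in S -> (forall e, e \in H -> v \notin e) ->
  (forall X F, #|X| < #|S| -> 7 <= #|X| -> F \subset triples X -> pfree F ->
    classified F X) -> classified H S.
Proof.
move=> sH pH S7 vS iso IH; have cS := cardsD1_in vS.
have sH' : H \subset triples (S :\ v).
  apply/subsetP => e eH; have [/subsetP eS e3] := tripleP sH eH.
  rewrite inE e3 eqxx andbT; apply/subsetP => z ze; rewrite !inE eS // andbT.
  by apply: contraNneq (iso _ eH) => <-.
have [e7|n7] := eqVneq #|S| 7.
  constructor 3; constructor 1; split=> //; exists (S :\ v).
  by rewrite subsetDl cS e7.
have S8 : 8 <= #|S| by card_lia.
have lt : #|S :\ v| < #|S| by rewrite cS; card_lia.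
have ge : 7 <= #|S :\ v| by rewrite cS; card_lia.
have mono : second_max (#|S| - 1) <= second_max #|S|.
  have [->|n8] := eqVneq #|S| 8; first by [].
  have [->|n13] := eqVneq #|S| 13; first by [].
  by apply/ltnW/second_max_lt => //; card_lia.
case: (IH _ _ lt ge sH' pH) => [h|[x hx]|h].
- by constructor 1; rewrite cS in h; card_lia.
- by constructor 2; exists x.
have [e8|n8] := eqVneq #|S| 8.
  have c7 : #|S :\ v| = 7 by rewrite cS e8.
  case: h; rewrite c7 => -[] // _ [A [AS A6 HA]].
  have AS' : A \subset S by apply: subset_trans AS (subsetDl _ _).
  have le := subset_leq_card HA; rewrite card_triples A6 in le.
  have [lt20|ge20] := ltnP #|H| 20; first by constructor 1; rewrite e8.
  (* Two vertices lie outside A, so the second clique contributes no triples and H is all of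
     [triples A]. *)
  constructor 3; constructor 2; rewrite e8; split=> //; exists A; split=> //.
  apply/eqP; rewrite eqEcard; apply/andP; split.
    by apply: subset_trans HA (subsetUl _ _).
  apply: leq_trans (leq_card_setU _ _).1 _.
  by rewrite !card_triples cardsD (setIidPr AS') A6 e8.
have S9 : 9 <= #|S| by card_lia.
have cH := card_extremal2 _ h; rewrite cS in cH.
have [e13|n13] := eqVneq #|S| 13; last first.
  by constructor 1; rewrite cH ?second_max_lt //; card_lia.
have c12 : #|S :\ v| = 12 by rewrite cS e13.
case: h; rewrite c12 => -[] // _ [A [AS A6 HA]].
constructor 3; constructor 3; split=> //; exists A, (S :\ v :\: A); split=> //.
- by apply: subset_trans AS (subsetDl _ _).
- by apply: subset_trans (subsetDl _ _) (subsetDl _ _).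
- by rewrite -setI_eq0 setIDA setIC -setIDA setDv setI0.
- by rewrite cardsD (setIidPr AS) A6 c12.
Qed.

Lemma first_max_bound S : 7 <= #|S| ->
  (forall X F, #|X| < #|S| -> 7 <= #|X| -> F \subset triples X -> pfree F ->
    classified F X) ->
  forall X F, #|X| < #|S| -> F \subset triples X -> pfree F -> #|F| <= first_max #|X|.
Proof.
move=> S7 IH X F XS sF pF; have [X7|X6] := ltnP 6 #|X|.
  by apply: classified_le (IH _ _ XS X7 sF pF).
by rewrite /first_max X6 -card_triples; apply: subset_leq_card.
Qed.

(** Once isolated vertices are dealt with, each part has at least three vertices, and the sizes of
    the parts decide. *)
Lemma disconnected_classified H S A : H \subset triples S -> pfree H -> 7 <= #|S| ->
  A \subset S -> A != set0 -> A != S ->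
  (forall e, e \in H -> meet e A -> e \subset A) ->
  (forall X F, #|X| < #|S| -> 7 <= #|X| -> F \subset triples X -> pfree F ->
    classified F X) -> classified H S.
Proof.
move=> sH pH S7 AS A0 AnS clA IH.
have [/existsP[v /andP[vS /forallP iso]]|noiso] :=
    boolP [exists v, (v \in S) && [forall e in H, v \notin e]].
  by apply: (isolated_classified sH pH S7 vS _ IH) => e eH; move: (iso e); rewrite eH.
have edge v : v \in S -> exists2 e, e \in H & v \in e.
  move=> vS; move: noiso; rewrite negb_exists => /forallP/(_ v).
  rewrite vS negb_forall => /existsP[e]; rewrite negb_imply negbK => /andP[eH ve].
  by exists e.
have IHw := first_max_bound S7 IH.
(* If one of the parts has six vertices, call it A. *)
wlog nice : A AS A0 AnS clA / #|A| = 6 \/ (#|A| != 6 /\ #|S :\: A| != 6).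
  move=> wlog_nice; have [h|nA] := eqVneq #|A| 6; first by apply: (wlog_nice A) => //; left.
  have [h|nB] := eqVneq #|S :\: A| 6; last by apply: (wlog_nice A) => //; right.
  apply: (wlog_nice (S :\: A)); first exact: subsetDl.
  - by rewrite -card_gt0 h.
  - apply: contraNneq A0 => eD; rewrite -subset0; apply/subsetP => z zA.
    by have := subsetP AS _ zA; rewrite -{1}eD inE zA.
  - move=> e eH /meetP[z ze]; rewrite inE => /andP[zA zS].
    have [eS _] := tripleP sH eH; apply/subsetP => y ye; rewrite inE (subsetP eS) // andbT.
    apply: contra zA => yA; apply: (subsetP (clA _ eH _)) => //.
    by apply/meetP; exists y.
  - by left.
set B := S :\: A in nice *.
have cS : #|A| + #|B| = #|S|.
  by have := cardsID A S; rewrite (setIidPr AS).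
have B0 : B != set0.
  by apply: contra AnS; rewrite setD_eq0 => h; rewrite eqEsubset AS.
have clB e : e \in H -> meet e B -> e \subset B.
  move=> eH /meetP[z ze]; rewrite inE => /andP[zA zS].
  have [eS _] := tripleP sH eH; apply/subsetP => y ye; rewrite inE (subsetP eS) // andbT.
  apply: contra zA => yA; apply: (subsetP (clA _ eH _)) => //.
  by apply/meetP; exists y.
have three X : X \subset S -> X != set0 -> (forall e, e \in H -> meet e X -> e \subset X) -> 3 <= #|X|.
  move=> XS /set0Pn[v vX] clX; have [e eH ve] := edge v (subsetP XS _ vX).
  have [_ <-] := tripleP sH eH; apply: subset_leq_card; apply: clX => //.
  by apply/meetP; exists v.
have A3 := three A AS A0 clA; have B3 := three B (subsetDl _ _) B0 clB.
pose FA := [set e in H | e \subset A]; pose FB := [set e in H | e \subset B].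
have sFA : FA \subset triples A.
  by apply/subsetP => e; rewrite !inE => /andP[eH ->]; have [_ ->] := tripleP sH eH.
have sFB : FB \subset triples B.
  apply/subsetP => e; rewrite in_set => /andP[eH eB]; rewrite in_set eB.
  by have [_ ->] := tripleP sH eH.
have HAB : H \subset FA :|: FB.
  apply/subsetP => e eH; rewrite in_setU in_set [X in _ || X]in_set eH /=.
  have [/clA -> //|nm] := boolP (meet e A); apply/orP; right.
  apply: clB => //; have [eS e3] := tripleP sH eH.
  have /card_gt0P[z ze] : 0 < #|e| by rewrite e3.
  apply/meetP; exists z => //; rewrite inE (subsetP eS) // andbT.
  by apply: contra nm => zA; apply/meetP; exists z.
have leH := card_leU HAB.
have pFA : pfree FA by apply: pfreeS pH; apply/subsetP => e; rewrite inE => /andP[].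
have pFB : pfree FB by apply: pfreeS pH; apply/subsetP => e; rewrite in_set => /andP[].
have lA : #|FA| <= first_max #|A| by apply: IHw sFA pFA; card_lia.
have lB : #|FB| <= first_max #|B| by apply: IHw sFB pFB; card_lia.
case: nice => [A6|[nA nB]]; last first.
  constructor 1; rewrite -cS; apply: leq_ltn_trans leH _.
  apply: leq_ltn_trans (leq_add lA lB) _; apply: second_max_split => //.
  by rewrite cS.
rewrite A6 (_ : first_max 6 = 20) // in lA.
have eS : #|S| = 6 + #|B| by rewrite -cS A6.
have [B8|B7] := ltnP 7 #|B|.
  by constructor 1; rewrite eS; have := second_max_split6 B8; card_lia.
have [b7|nb7] := eqVneq #|B| 7.
  have e13 : #|S| = 13 by rewrite eS b7.
  (* The bound 20 for seven vertices would only give 40. It comes from a K6, which would leave an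
     isolated vertex in B; all other alternatives give at most 15. *)
  suff : #|FB| <= 15 by constructor 1; rewrite e13 (_ : second_max 13 = 40) //; card_lia.
  have BS : #|B| < #|S| by rewrite b7 e13.
  have B7' : 7 <= #|B| by rewrite b7.
  case: (IH _ _ BS B7' sFB pFB) => [|[x hx]|].
  - by rewrite b7 (_ : second_max 7 = 15) // => /ltnW.
  - by have := star_le sFB hx; rewrite b7.
  case; rewrite b7 => -[] // _ [A' [A'B A'6 FBA']].
  have /card_gt0P[v] : 0 < #|B :\: A'| by rewrite cardsD (setIidPr A'B) b7 A'6.
  rewrite in_setD => /andP[vA' vB].
  have [e eH ve] := edge v (subsetP (subsetDl _ _) _ vB).
  have eFB : e \in FB by rewrite in_set eH clB //; apply/meetP; exists v.
  have [/subsetP eA' _] := tripleP FBA' eFB.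
  by rewrite eA' in vA'.
have B6 : #|B| <= 6 by card_lia.
have fB : first_max #|B| = 'C(#|B|, 3) by rewrite /first_max B6.
have fS : second_max #|S| = 20 + 'C(#|B|, 3).
  rewrite eS /second_max addKn.
  have -> : (6 + #|B| <= 7) = false by apply/negbTE; rewrite -ltnNge; card_lia.
  by have -> : 6 + #|B| <= 12 by card_lia.
have [lt|ge] := ltnP #|H| (second_max #|S|); first by constructor 1.
constructor 3; constructor 2; split; first by card_lia.
exists A; split=> //; apply/eqP; rewrite eqEcard -/B; apply/andP; split.
  by apply: subset_trans HAB (setUSS sFA sFB).
by apply: leq_trans (leq_card_setU _ _).1 _; rewrite !card_triples A6; rewrite fS in ge.
Qed.

(** Connectedness yields disjoint edges e, f and an edge g meeting both. Path-freeness forces g to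
    share two vertices with one of them, and these form the spine. *)
Lemma connected_two_pages H S e1 e2 : H \subset triples S -> pfree H -> connected H S ->
  e1 \in H -> e2 \in H -> [disjoint e1 & e2] ->
  exists a b c d D, [/\ c \in pages a b H, d \in pages a b H, D \in rest a b H, d \in D & c \notin D].
Proof.
move=> sH pH conn e1H e2H d12.
have [e [f [g [eH fH gH def [mge mgf]]]]] : exists e f g,
    [/\ e \in H, f \in H, g \in H, [disjoint e & f] & meet g e /\ meet g f].
  (* The union of the edges meeting e1. If it meets e2, one of these edges joins e1 to e2; otherwise
     an edge g leaving A is disjoint from e1 but meets an edge that meets e1. *)
  pose A := [set z | [exists h in H, (meet h e1) && (z \in h)]].
  have inA h z : h \in H -> meet h e1 -> z \in h -> z \in A.
    by move=> hH mh zh; rewrite inE; apply/existsP; exists h; rewrite hH mh.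
  have AP z : z \in A -> exists h, [/\ h \in H, meet h e1 & z \in h].
    by rewrite inE => /existsP[h /and3P[? ? ?]]; exists h.
  have AS : A \subset S.
    apply/subsetP => z /AP[h [hH _ zh]]; have [/subsetP hS _] := tripleP sH hH; exact: hS.
  have [_ e13] := tripleP sH e1H; have [e2S e23] := tripleP sH e2H.
  have [x xe1] : exists x, x \in e1 by apply/card_gt0P; rewrite e13.
  have [y ye2] : exists y, y \in e2 by apply/card_gt0P; rewrite e23.
  have [yA|yA] := boolP (y \in A).
    have [h [hH mh yh]] := AP _ yA; exists e1, e2, h; split=> //; split=> //.
    by apply/meetP; exists y.
  have A0 : A != set0.
    by apply/set0Pn; exists x; apply: (inA _ _ e1H _ xe1); apply/meetP; exists x.
  have AnS : A != S by apply: contraNneq yA => ->; apply: (subsetP e2S).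
  have [g [gH /meetP[z zg /AP[h [hH mh zh]]] gA]] := conn A AS A0 AnS.
  exists e1, g, h; split=> //; last by split=> //; apply/meetP; exists z.
  rewrite disjoint_sym; apply: contraNT gA => mg; apply/subsetP => t tg; exact: (inA g).
have finish e' f' : e' \in H -> f' \in H -> [disjoint e' & f'] -> meet g f' -> 1 < #|g :&: e'| ->
    exists a b c d D, [/\ c \in pages a b H, d \in pages a b H, D \in rest a b H, d \in D & c \notin D].
  move=> e'H f'H dis /meetP[d dg df'] /card_gt1P[a [b [+ + ab]]].
  rewrite !inE => /andP[ag ae] /andP[bg be].
  have [[_ g3] [_ e3]] := (tripleP sH gH, tripleP sH e'H).
  have [c [ee ac bc]] := triple_pick1 e3 ae be ab.
  have ce : c \in e' by rewrite ee !inE eqxx !orbT.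
  have nf z : z \in e' -> z \notin f' by move=> ze; rewrite (disjointFr dis ze).
  have da : a != d by apply: contraTneq df' => <-; apply: nf.
  have db : b != d by apply: contraTneq df' => <-; apply: nf.
  exists a, b, c, d, f'; split=> //; rewrite ?nf //.
  - by rewrite inE -ee.
  - by rewrite inE -(triple_eq g3 ag bg dg ab da db).
  - by rewrite inE f'H !nf.
have [lt|ge] := ltnP 1 #|g :&: e|; first exact: (finish e f).
have [lt|ge'] := ltnP 1 #|g :&: f|; first by apply: (finish f e) => //; rewrite disjoint_sym.
have pos h : meet g h -> 0 < #|g :&: h|.
  by case/meetP=> z zg zh; apply/card_gt0P; exists z; rewrite inE zg.
by case: (pH e f g eH fH gH def); have := pos _ mge; have := pos _ mgf; card_lia.
Qed.

Theorem classification H S : 7 <= #|S| -> H \subset triples S -> pfree H -> classified H S.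
Proof.
have [n] := ubnP #|S|; elim: n => // n IHn in S H *; rewrite ltnS => Sn S7 sH pH.
have IH X F : #|X| < #|S| -> 7 <= #|X| -> F \subset triples X -> pfree F -> classified F X.
  by move=> XS X7; apply: IHn => //; apply: leq_trans XS Sn.
have [/existsP[x /forallP hx]|nostar] := boolP [exists x, forall e in H, x \in e].
  by constructor 2; exists x => e eH; move: (hx e); rewrite eH.
have {}nostar z : ~ forall e, e \in H -> z \in e.
  move=> hz; move: nostar; rewrite negb_exists => /forallP/(_ z)/negP; apply.
  by apply/forallP => e; apply/implyP/hz.
have [/forallP int|] := boolP [forall e in H, forall f in H, meet e f].
  have int' : intersecting H.
    by move=> e f eH fH; move: (int e); rewrite eH /= => /forallP/(_ f); rewrite fH.
  have := intersecting_nontrivial sH int' S7 nostar; constructor 1.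
  have [e7|n7] := eqVneq #|S| 7; first by move: H0; rewrite e7.
  move: H0; rewrite ifN // => le; apply: leq_ltn_trans le _; apply: second_max_ge_star.
  by card_lia.
rewrite negb_forall => /existsP[e1]; rewrite negb_imply negb_forall => /andP[e1H /existsP[e2]].
rewrite negb_imply negbK => /andP[e2H d12].
have [/existsP[A /and4P[AS A0 AnS /forallP clA]]|nA] := boolP [exists A : {set V},
    [&& A \subset S, A != set0, A != S & [forall e in H, meet e A ==> (e \subset A)]]].
  apply: (disconnected_classified sH pH S7 AS A0 AnS _ IH) => e eH.
  by move: (clA e); rewrite eH /= => /implyP.
have conn : connected H S.
  move=> A AS A0 AnS; move: nA; rewrite negb_exists => /forallP/(_ A).
  rewrite AS A0 AnS /= negb_forall => /existsP[e]; rewrite !negb_imply => /and3P[eH me nsub].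
  by exists e.
have [fk|nf] := forkedP H; first exact: forked_classified IH.
have [a [b [c [d [D [cT dT DR dD cD]]]]]] := connected_two_pages sH pH conn e1H e2H d12.
constructor 1; apply: (unforked_small pH sH nf S7 conn cT dT DR dD cD).
exact: (first_max_bound S7 IH).
Qed.

End Classification.

(** * The extremal systems *)

Section PathFreeExamples.
Variable V : finType.
Implicit Types (a b c d u v w x y z : V) (p q r s e f g h S A B D E T X Y Z : {set V})
  (G H F : {set {set V}}).

Lemma triple_in A e : (e \in triples A) -> e \subset A /\ #|e| = 3.
Proof. by rewrite inE => /andP[-> /eqP]. Qed.

(** Two disjoint edges exhaust the six vertices, so the middle edge cannot have just one vertex in
    each. *)
Lemma pfree_triples A : #|A| <= 6 -> pfree (triples A).
Proof.
move=> A6 e f g /triple_in[eA e3] /triple_in[fA f3] /triple_in[gA g3] dis m1 m2.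
move: dis; rewrite -setI_eq0 => /eqP dis.
have cU : #|e :|: f| = 6 by rewrite cardsU dis cards0 e3 f3.
have eU : e :|: f = A by apply/eqP; rewrite eqEcard cU A6 subUset eA fA.
have : g = (g :&: e) :|: (g :&: f) by rewrite -setIUr eU (setIidPl gA).
move/(congr1 (fun s : {set V} => #|s|)); rewrite g3 cardsU m1 m2.
by case: #|_ :&: _| => [|[]].
Qed.

Lemma pfree_union A B F1 F2 : F1 \subset triples A -> F2 \subset triples B ->
  [disjoint A & B] -> pfree F1 -> pfree F2 -> pfree (F1 :|: F2).
Proof.
have key A1 A2 G1 G2 : G1 \subset triples A1 -> G2 \subset triples A2 -> [disjoint A1 & A2] ->
    forall e g, e \in G1 :|: G2 -> g \in G1 -> #|g :&: e| = 1 -> e \in G1.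
  move=> s1 s2 dis e g; rewrite in_setU => /orP[//|e2] g1 m; exfalso.
  have /card_gt0P[z] : 0 < #|g :&: e| by rewrite m.
  rewrite inE => /andP[zg ze]; have [/subsetP eA _] := tripleP s2 e2.
  have [/subsetP gA _] := tripleP s1 g1.
  by have := disjointFr dis (gA _ zg); rewrite (eA _ ze).
move=> s1 s2 dis p1 p2 e f g eF fF gF def m1 m2.
have dis' : [disjoint B & A] by rewrite disjoint_sym.
move: (gF); rewrite in_setU => /orP[g1|g2].
  by apply: (p1 e f g) => //; [apply: key s1 s2 dis e g eF g1 m1|apply: key s1 s2 dis f g fF g1 m2].
rewrite setUC in eF fF.
by apply: (p2 e f g) => //; [apply: key s2 s1 dis' e g eF g2 m1|apply: key s2 s1 dis' f g fF g2 m2].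
Qed.

Lemma pfree_full_star d X : pfree (full_star d X).
Proof.
move=> e f g; rewrite !inE => /andP[_ de] /andP[_ df] _ dis.
by rewrite (disjointFr dis de) in df.
Qed.

Lemma comet_on_sub d A X : d \in A -> A \subset X -> comet_on d A X \subset triples X.
Proof.
move=> dA AX; rewrite subUset triplesS //=; apply/subsetP => e; rewrite inE => /andP[eT _].
apply: (subsetP (triplesS _)) eT; rewrite subUset sub1set (subsetP AX) //=; exact: subsetDl.
Qed.

(** Disjoint edges of a comet are [A :\ d] and a star edge. A third edge inside A meets [A :\ d] at
    least twice, and a third edge in the star does not meet it. *)
Lemma pfree_comet_on d A X : d \in A -> #|A| = 4 -> pfree (comet_on d A X).
Proof.
move=> dA A4; set R := d |: (X :\: A).
have key e f g : e \in triples A -> f \in full_star d R -> g \in comet_on d A X ->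
    [disjoint e & f] -> #|g :&: e| = 1 -> #|g :&: f| = 1 -> False.
  move=> /triple_in[eA e3]; rewrite inE => /andP[/triple_in[fR f3] df] gC dis m1 m2.
  have de : d \notin e by rewrite (disjointFl dis df).
  have eAd : e = A :\ d.
    apply/eqP; rewrite eqEcard cardsD1_in // A4 e3 leqnn andbT.
    by apply/subsetP => z ze; rewrite !inE (subsetP eA) // andbT; apply: contraNneq de => <-.
  move: gC; rewrite in_setU => /orP[/triple_in[gA g3]|].
    have := cardsUI g e; rewrite m1 g3 e3.
    have : #|g :|: e| <= 4 by rewrite -A4; apply: subset_leq_card; rewrite subUset gA.
    by card_lia.
  rewrite inE => /andP[/triple_in[/subsetP gR _] _].
  have /card_gt0P[z] : 0 < #|g :&: e| by rewrite m1.
  rewrite inE => /andP[/gR + ze]; rewrite !inE (subsetP eA _ ze) /= orbF => /eqP zd.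
  by rewrite -zd ze in de.
move=> e f g eC fC gC dis m1 m2; move: (eC) (fC); rewrite !in_setU.
case/orP=> [eA|eS] /orP[fA|fS].
- have [[eA' e3] [fA' f3]] := (triple_in eA, triple_in fA).
  have := cardsUI e f; move: dis; rewrite -setI_eq0 => /eqP->; rewrite cards0 e3 f3.
  have : #|e :|: f| <= 4 by rewrite -A4; apply: subset_leq_card; rewrite subUset eA'.
  by card_lia.
- exact: (key e f g).
- by apply: (key f e g) => //; rewrite disjoint_sym.
- move: eS fS; rewrite !inE => /andP[_ de] /andP[_ df].
  by rewrite (disjointFr dis de) in df.
Qed.

Lemma triples_avoiding A x : 4 <= #|A| -> exists2 e, e \in triples A & x \notin e.
Proof.
move=> A4; have : 2 < #|A :\ x| by have := cardsD1 x A; case: (x \in A); card_lia.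
case/card_gt2P=> u [v [w [[uA vA wA] [uv vw wu]]]].
exists [set u; v; w].
  rewrite inE cards3 // 1?eq_sym // andbT; apply/subsetP => z.
  by rewrite in_setU in_setU !in_set1 => /orP[/orP[]|]/eqP->;
    [move: uA|move: vA|move: wA]; rewrite inE => /andP[].
move: uA vA wA; rewrite !inE => /andP[ux _] /andP[vx _] /andP[wx _].
by rewrite !negb_or !(eq_sym x) ux vx wx.
Qed.

Lemma extremal2_sub F X : 8 <= #|X| -> extremal2 F X -> F \subset triples X.
Proof.
move=> X8 [[e _]|[_ [A [AX _ ->]]]|[_ [A [B [AX BX _ _ ->]]]]|[_ [d [A [dA AX _ ->]]]]].
- by rewrite e in X8.
- by rewrite subUset !triplesS // subsetDl.
- by rewrite subUset !triplesS.
- exact: comet_on_sub.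
Qed.

Lemma extremal2_pfree F X : 8 <= #|X| -> extremal2 F X -> pfree F.
Proof.
move=> X8 [[e _]|[/andP[_ X12] [A [AX A6 ->]]]|[_ [A [B [AX BX dis [A6 B6] ->]]]]|[_ [d [A [dA AX A4 ->]]]]].
- by rewrite e in X8.
- apply: (pfree_union (subxx _) (subxx _)).
  + by rewrite -setI_eq0 setIDA setIC -setIDA setDv setI0.
  + by apply: pfree_triples; rewrite A6.
  + by apply: pfree_triples; rewrite cardsD (setIidPr AX) A6; card_lia.
- by apply: (pfree_union (subxx _) (subxx _) dis); apply: pfree_triples; rewrite ?A6 ?B6.
- exact: pfree_comet_on.
Qed.

Lemma extremal2_nonstar F X x : 8 <= #|X| -> extremal2 F X -> ~ forall e, e \in F -> x \in e.
Proof.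
have K A G : 4 <= #|A| -> ~ forall e, e \in triples A :|: G -> x \in e.
  move=> A4 h; have [e eA xe] := triples_avoiding x A4.
  by move/negP: xe; apply; apply: h; rewrite in_setU eA.
move=> X8 [[e _]|[/andP[_ X12] [A [AX A6 ->]]]|[_ [A [B [AX BX dis [A6 B6] ->]]]]|[_ [d [A [dA AX A4 ->]]]]].
- by rewrite e in X8.
- by apply: K; rewrite A6.
- by apply: K; rewrite A6.
- by apply: K; rewrite A4.
Qed.

End PathFreeExamples.

(** * Permutations acting on triple systems *)

Section Images.
Variable V : finType.
Implicit Types (s : {perm V}) (A X e : {set V}) (H F : {set {set V}}) (d : V).

Definition perm_image s H : {set {set V}} := [set s @: e | e : {set V} in H].

Lemma perm_imageK s : cancel (perm_image s) (perm_image (s^-1)%g).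
Proof.
move=> H; rewrite /perm_image -imset_comp -[RHS]imset_id; apply: eq_imset => e /=.
by rewrite -imset_comp -[RHS]imset_id; apply: eq_imset => x /=; rewrite permK.
Qed.

Lemma mem_perm_imageV s H e : (e \in perm_image s H) = ((s^-1)%g @: e \in H).
Proof.
have Kset (t : {perm V}) (f : {set V}) : t @: ((t^-1)%g @: f) = f.
  by rewrite -imset_comp -[RHS]imset_id; apply: eq_imset => x /=; rewrite permKV.
apply/imsetP/idP => [[f fH ->]|eH]; last by exists ((s^-1)%g @: e).
by have := Kset (s^-1)%g f; rewrite invgK => ->.
Qed.

Lemma perm_imageU s H F : perm_image s (H :|: F) = perm_image s H :|: perm_image s F.
Proof. exact: imsetU. Qed.

Lemma mem_permV s A x : ((s^-1)%g x \in A) = (x \in s @: A).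
Proof. by rewrite -{2}[x](permKV s) mem_imset //; exact: perm_inj. Qed.

Lemma imset_permV s A e : ((s^-1)%g @: e \subset A) = (e \subset s @: A).
Proof.
apply/subsetP/subsetP => h x.
  by move=> xe; rewrite -mem_permV h ?imset_f.
by case/imsetP=> y ye ->; rewrite mem_permV h.
Qed.

Lemma perm_image_triples s A : perm_image s (triples A) = triples (s @: A).
Proof.
apply/setP => e; rewrite mem_perm_imageV !inE imset_permV card_imset //; exact: perm_inj.
Qed.

Lemma perm_image_full_star s d X : perm_image s (full_star d X) = full_star (s d) (s @: X).
Proof.
apply/setP => e; rewrite mem_perm_imageV !inE imset_permV card_imset; last exact: perm_inj.
by congr (_ && _); rewrite -{1}[d](permK s) mem_imset //; exact: perm_inj.
Qed.

Lemma imset_permD s A X : s @: (X :\: A) = s @: X :\: s @: A.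
Proof. by apply/setP => x; rewrite in_setD -!mem_permV in_setD. Qed.

Lemma imset_permT s : s @: [set: V] = [set: V].
Proof. by apply/setP => x; rewrite -mem_permV !inE. Qed.

Lemma perm_image_comet_on s d A X : perm_image s (comet_on d A X) = comet_on (s d) (s @: A) (s @: X).
Proof. by rewrite perm_imageU perm_image_triples perm_image_full_star imsetU1 imset_permD. Qed.

End Images.

(** Equal colour multiplicities make the two colour lists permutations of each other. *)
Lemma perm_of_colors n (T : eqType) (c1 c2 : 'I_n -> T) :
  (forall k, #|[set x | c1 x == k]| = #|[set x | c2 x == k]|) ->
  exists s : {perm 'I_n}, forall x, c2 (s x) = c1 x.
Proof.
move=> h; have /tuple_permP[s es] : perm_eq [tuple c1 x | x < n] [tuple c2 x | x < n].
  apply/allP => k _ /=; apply/eqP.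
  have cnt c : count_mem k [tuple c x | x < n] = #|[set x | c x == k]|.
    by rewrite /= count_map -sum1_count big_enum_cond /= sum1dep_card.
  by rewrite !cnt.
exists s => x; have := congr1 (fun t => nth (c1 x) t x) es.
by rewrite -!tnth_nth !tnth_mktuple.
Qed.

(** * Turán numbers *)

(** Colour each vertex by its membership in the two sets; the three cardinalities determine all four
    class sizes. *)
Lemma perm_of_two_sets n (A B A0 B0 : {set 'I_n}) :
  #|A| = #|A0| -> #|B| = #|B0| -> #|A :&: B| = #|A0 :&: B0| ->
  exists s : {perm 'I_n}, s @: A = A0 /\ s @: B = B0.
Proof.
move=> cA cB cAB.
have cnt (X Y : {set 'I_n}) k :
    #|[set x | (x \in X, x \in Y) == k]| =
    match k with
    | (true, true) => #|X :&: Y| | (true, false) => #|X| - #|X :&: Y|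
    | (false, true) => #|Y| - #|X :&: Y| | (false, false) => n - (#|X| + #|Y| - #|X :&: Y|)
    end.
  case: k => [[] []].
  - by apply: eq_card => x; rewrite !inE xpair_eqE !eqb_id.
  - by rewrite -cardsD; apply: eq_card => x; rewrite !inE xpair_eqE eqb_id eqbF_neg andbC.
  - by rewrite setIC -cardsD; apply: eq_card => x; rewrite !inE xpair_eqE eqb_id eqbF_neg.
  - rewrite -cardsU; have <- : ~: (X :|: Y) = [set x | (x \in X, x \in Y) == (false, false)].
      by apply/setP => x; rewrite !inE xpair_eqE !eqbF_neg negb_or.
    by have := cardsC (X :|: Y); rewrite card_ord; card_lia.
have [s hs] : exists s : {perm 'I_n}, forall x,
    (s x \in A0, s x \in B0) = (x \in A, x \in B).
  by apply: (@perm_of_colors n _ (fun x => (x \in A, x \in B))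
    (fun x => (x \in A0, x \in B0))) => k; rewrite !cnt cA cB cAB.
exists s; split; apply/setP => x; rewrite -mem_permV; have := hs ((s^-1)%g x);
  by rewrite permKV => -[hA hB].
Qed.

Lemma uniform3E n (H : hgraph n) : uniform3 H = (H \subset triples setT).
Proof.
apply/forall_inP/subsetP => h e eH; first by rewrite inE subsetT h.
by have := h e eH; rewrite inE => /andP[].
Qed.

(** Disjoint end edges and a middle edge meeting each exactly once span seven distinct vertices,
    which is the loose path. *)
Lemma containsP n (H : hgraph n) : H \subset triples setT -> ~~ contains Ppath H <-> pfree H.
Proof.
move=> sH; split=> [nc e f g eH fH gH dis m1 m2|pH].
  have [[_ e3] [_ f3]] := (tripleP sH eH, tripleP sH fH); have [_ g3] := tripleP sH gH.
  move/eqP/cards1P: m1 => [c ec]; move/eqP/cards1P: m2 => [x ex].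
  have [cg ce] : c \in g /\ c \in e by apply/andP; rewrite -in_setI ec inE.
  have [xg xf] : x \in g /\ x \in f by apply/andP; rewrite -in_setI ex inE.
  have nef z : z \in e -> z \in f -> False by move=> ze; rewrite (disjointFr dis ze).
  have cx : c != x by apply/eqP => cx; apply: (nef c) => //; rewrite cx.
  have [a [b [ee ca cb ab]]] := triple_pick2 e3 ce.
  have [y [z [ef xy xz yz]]] := triple_pick2 f3 xf.
  have [d [eg cd xd]] := triple_pick1 g3 cg xg cx.
  have ae : a \in e by rewrite ee !inE eqxx orbT.
  have be : b \in e by rewrite ee !inE eqxx !orbT.
  have yf : y \in f by rewrite ef !inE eqxx orbT.
  have zf : z \in f by rewrite ef !inE eqxx !orbT.
  have dg : d \in g by rewrite eg !inE eqxx !orbT.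
  have de : d \notin e.
    by apply: contraNN cd => de; rewrite eq_sym -in_set1 -ec inE dg.
  have df : d \notin f.
    by apply: contraNN xd => df; rewrite eq_sym -in_set1 -ex inE dg.
  have neq u v : u \in e -> v \in f -> u != v.
    by move=> ue vf; apply/eqP => uv; apply: (nef u ue); rewrite uv.
  have ned u : u \in e -> u != d by move=> ue; apply: contraNneq de => <-.
  have nfd u : u \in f -> d != u by move=> ue; apply: contraNneq df => ->.
  (* Listed along the path, with the joints c and x in positions 2 and 4 as in [Ppath]. *)
  pose L := [:: a; b; c; d; x; y; z].
  have uL : uniq L.
    have [ax ay az] : [/\ a != x, a != y & a != z] by split; apply: neq.
    have [bx by_ bz] : [/\ b != x, b != y & b != z] by split; apply: neq.
    have [cy cz] : c != y /\ c != z by split; apply: neq.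
    have [ad bd] : a != d /\ b != d by split; apply: ned.
    have [dx dy dz] : [/\ d != x, d != y & d != z] by split; apply: nfd.
    rewrite /= !inE !negb_or ab ad ax ay az bd bx by_ bz cd cx cy cz dx dy dz xy xz yz.
    by rewrite !(eq_sym _ c) ca cb.
  move/negP: nc; apply; apply/existsP; exists [ffun i : 'I_7 => nth a L i].
  apply/andP; split.
    apply/injectiveP => i j; rewrite !ffunE => /eqP; rewrite nth_uniq ?ltn_ord //.
    by move/eqP/val_inj.
  apply/forall_inP => t; rewrite !inE => /orP[/orP[]|] /eqP->;
    rewrite !imsetU !imset_set1 !ffunE !inordK //=.
  - by rewrite -(triple_eq e3 ae be ce ab) // eq_sym.
  - by rewrite -(triple_eq g3 cg dg xg cd cx) // eq_sym.
  - by rewrite -ef.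
apply/negP => /existsP[f /andP[/injectiveP finj /forall_inP fP]].
have inP t : t \in Ppath -> f @: t \in H := fP t.
have img (A B : {set 'I_7}) : f @: A :&: f @: B = f @: (A :&: B).
  by apply/esym/imsetI => u v _ _; apply: finj.
have h0 := inP _ (_ : [set inord 0; inord 1; inord 2] \in Ppath).
have h1 := inP _ (_ : [set inord 2; inord 3; inord 4] \in Ppath).
have h2 := inP _ (_ : [set inord 4; inord 5; inord 6] \in Ppath).
apply: (pH _ _ _ (h0 _) (h2 _) (h1 _)); rewrite ?inE ?eqxx ?orbT //.
- rewrite -setI_eq0 img imset_eq0; apply/eqP/setP => i.
  rewrite !inE -!val_eqE /= !inordK //.
  by case: i => -[|[|[|[|[|[|[|]]]]]]].
- rewrite img card_imset //; apply/eqP/cards1P; exists (inord 2); apply/setP => i.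
  rewrite !inE -!val_eqE /= !inordK //.
  by case: i => -[|[|[|[|[|[|[|]]]]]]].
- rewrite img card_imset //; apply/eqP/cards1P; exists (inord 4); apply/setP => i.
  rewrite !inE -!val_eqE /= !inordK //.
  by case: i => -[|[|[|[|[|[|[|]]]]]]].
Qed.

Lemma in_adm n (C : {set hgraph n}) (H : hgraph n) : H \in adm Ppath C <->
  [/\ H \subset triples setT, pfree H & forall G, G \in C -> ~ H \subset G].
Proof.
rewrite inE uniform3E; split=> [/and3P[sH /(containsP sH) pH nC]|[sH pH nC]].
  split=> // G GC HG; move/negP: nC; apply; apply/existsP; exists G; exact/andP.
rewrite sH /=; apply/andP; split; first exact/(containsP sH).
by apply/negP => /existsP[G /andP[GC HG]]; exact: nC GC HG.
Qed.

Lemma maxsize_extremal n (A : {set hgraph n}) m (G0 : hgraph n) :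
  (forall G, G \in A -> #|G| <= m) -> G0 \in A -> #|G0| = m ->
  maxsize A = m /\ forall H, H \in extremal A <-> H \in A /\ #|H| = m.
Proof.
move=> le G0A cG0; have e : maxsize A = m.
  apply/eqP; rewrite eqn_leq; apply/andP; split; first exact/bigmax_leqP.
  by rewrite -cG0 /maxsize; apply: (@leq_bigmax_cond _ _ (fun G : hgraph n => #|G|)).
split=> // H; rewrite inE e; split=> [/andP[-> /eqP->] //|[-> ->]]; by rewrite eqxx.
Qed.

Lemma in_Ex_upto1_7 n (G : hgraph n) : n = 7 ->
  G \in Ex_upto Ppath n 1 <-> exists A : {set 'I_n}, #|A| = 6 /\ G = triples A.
Proof.
move=> e7; have cT : #|[set: 'I_n]| = 7 by rewrite cardsT card_ord.
have bound H : H \in adm Ppath (set0 : {set hgraph n}) -> #|H| <= 20.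
  case/in_adm=> sH pH _; have := classified_le sH _ (classification _ sH pH).
  by rewrite cT; apply.
have adm0 (A : {set 'I_n}) : #|A| = 6 -> triples A \in adm Ppath (set0 : {set hgraph n}).
  move=> A6; apply/in_adm; split=> [||H]; last by rewrite inE.
    by rewrite triplesS // subsetT.
  by apply: pfree_triples; rewrite A6.
have [A0 [_ A06]] : exists A0 : {set 'I_n}, A0 \subset setT /\ #|A0| = 6.
  exists (setT :\ cast_ord (esym e7) ord0); split; first exact: subsetT.
  by rewrite cardsD1_in ?inE // cT.
have c0 : #|triples A0| = 20 by rewrite card_triples A06.
have [_ ext] := maxsize_extremal bound (adm0 _ A06) c0.
rewrite /= set0U ext; split=> [[GA c20]|[A [A6 ->]]]; last first.
  by rewrite card_triples A6; split=> //; exact: adm0.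
have [sG pG _] := (in_adm _ _).1 GA.
have := classification _ sG pG; rewrite cT => /(_ isT) [|[x hx]|].
- by rewrite cT c20.
- by have := star_le sG hx; rewrite cT c20.
case; rewrite cT => -[] // _ [A [_ A6 GsA]]; exists A; split=> //.
by apply/eqP; rewrite eqEcard GsA card_triples A6 c20.
Qed.

Lemma in_Ex_upto1_8 n (G : hgraph n) : 8 <= n ->
  G \in Ex_upto Ppath n 1 <-> exists x, G = full_star x setT.
Proof.
move=> n8; have cT : #|[set: 'I_n]| = n by rewrite cardsT card_ord.
have T7 : 7 <= #|[set: 'I_n]| by rewrite cT ltnW.
have bound H : H \in adm Ppath (set0 : {set hgraph n}) -> #|H| <= 'C(n - 1, 2).
  case/in_adm=> sH pH _; have := classified_le sH T7 (classification T7 sH pH).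
  by rewrite cT first_max_large.
have adm0 x : full_star x setT \in adm Ppath (set0 : {set hgraph n}).
  apply/in_adm; split=> [||H]; last by rewrite inE.
    by apply/subsetP => e; rewrite inE => /andP[].
  exact: pfree_full_star.
have cstar x : #|full_star x [set: 'I_n]| = 'C(n - 1, 2) by rewrite card_full_star ?inE // cT.
have n0 : 0 < n by exact: leq_trans n8.
have [_ ext] := maxsize_extremal bound (adm0 (Ordinal n0)) (cstar _).
rewrite /= set0U ext; split=> [[GA cG]|[x ->]]; last by split; [exact: adm0|exact: cstar].
have [sG pG _] := (in_adm _ _).1 GA.
have lt := second_lt_first T7; rewrite cT first_max_large // in lt.
case: (classification T7 sG pG) => [|[x hx]|h].
- by rewrite cT cG => /ltn_trans/(_ lt); rewrite ltnn.
- exists x; apply/eqP; rewrite eqEcard cstar cG leqnn andbT.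
  by apply/subsetP => e eG; rewrite inE (subsetP sG) ?hx.
- have := card_extremal2 _ h; rewrite cT cG => /(_ n8) e.
  by rewrite -e ltnn in lt.
Qed.

Lemma Ex2_7 n : n = 7 -> ex Ppath n 2 = 15 /\
  forall H : hgraph n, H \in Ex Ppath n 2 <-> exists x, H = full_star x setT.
Proof.
move=> e7; have cT : #|[set: 'I_n]| = 7 by rewrite cardsT card_ord.
have T7 : 7 <= #|[set: 'I_n]| by rewrite cT.
have cstar x : #|full_star x [set: 'I_n]| = 15 by rewrite card_full_star ?inE // cT.
have cls (H : hgraph n) : H \in adm Ppath (Ex_upto Ppath n 1) ->
    #|H| < 15 \/ exists x, forall e, e \in H -> x \in e.
  case/in_adm=> sH pH nE; case: (classification T7 sH pH) => [|h|].
  - by rewrite cT; left.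
  - by right.
  - case; rewrite cT => -[] // _ [A [_ A6 HA]].
    by case: (nE (triples A)) => //; apply/in_Ex_upto1_7 => //; exists A.
have bound (H : hgraph n) : H \in adm Ppath (Ex_upto Ppath n 1) -> #|H| <= 15.
  move=> Ha; have [/ltnW //|[x hx]] := cls H Ha.
  by have [sH _ _] := (in_adm _ _).1 Ha; have := star_le sH hx; rewrite cT.
(* A vertex v outside the six-set A lies on an edge of the star, so the star is not contained in
   [triples A]. *)
have adm2 x : full_star x setT \in adm Ppath (Ex_upto Ppath n 1).
  apply/in_adm; split=> [||G /(in_Ex_upto1_7 _ e7)[A [A6 ->]] sub].
  - by apply/subsetP => e; rewrite inE => /andP[].
  - exact: pfree_full_star.
  have [v vA] : exists v, v \notin A.
    have n7 : 6 < n by rewrite e7.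
    have : 0 < #|~: A| by have := cardsC A; rewrite A6 card_ord; card_lia.
    by case/card_gt0P=> v; rewrite inE; exists v.
  have [u [w [uw ux wx uv wv]]] : exists u w, [/\ u != w, u != x, w != x, u != v & w != v].
    have : 2 < #|setT :\ v :\ x|.
      have := cardsD1 v [set: 'I_n]; have := cardsD1 x (setT :\ v); rewrite cT.
      by move: (v \in _) (x \in _) => [] []; card_lia.
    case/card_gt2P=> u [w [t [[uA wA _] [uw _ _]]]]; exists u, w.
    by move: uA wA; rewrite !inE !andbT => /andP[-> ->] /andP[-> ->].
  have [vx|vx] := eqVneq v x.
    have : [set x; u; w] \in triples A.
      by apply: (subsetP sub); rewrite !inE subsetT eqxx cards3 // eq_sym.
    by move=> /triple_in[/subsetP/(_ x)]; rewrite !inE eqxx -vx (negbTE vA) => /(_ isT).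
  have : [set x; u; v] \in triples A.
    by apply: (subsetP sub); rewrite !inE subsetT eqxx cards3 // eq_sym.
  by move=> /triple_in[/subsetP/(_ v)]; rewrite !inE eqxx !orbT (negbTE vA) => /(_ isT).
have x0 : 'I_n by rewrite e7; exact: ord0.
have [e ext] := maxsize_extremal bound (adm2 x0) (cstar x0).
split=> // H; rewrite ext; split=> [[Ha cH]|[x ->]]; last by split; [exact: adm2|exact: cstar].
have [|[x hx]] := cls H Ha; first by rewrite cH.
have [sH _ _] := (in_adm _ _).1 Ha.
exists x; apply/eqP; rewrite eqEcard cstar cH leqnn andbT.
by apply/subsetP => f fH; rewrite inE (subsetP sH) ?hx.
Qed.

(** The argument [G0] shows that the bound is attained; which system can serve depends on n. *)
Lemma Ex2_8 n (G0 : hgraph n) : 8 <= n -> extremal2 G0 setT -> ex Ppath n 2 = second_max n /\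
  forall H : hgraph n, H \in Ex Ppath n 2 <-> extremal2 H setT.
Proof.
move=> n8 ext0; have cT : #|[set: 'I_n]| = n by rewrite cardsT card_ord.
have T8 : 8 <= #|[set: 'I_n]| by rewrite cT.
have T7 := ltnW T8.
have cls (H : hgraph n) : H \in adm Ppath (Ex_upto Ppath n 1) ->
    #|H| < second_max n \/ extremal2 H setT.
  case/in_adm=> sH pH nE; case: (classification T7 sH pH) => [|[x hx]|].
  - by rewrite cT; left.
  - case: (nE (full_star x setT)); first by apply/in_Ex_upto1_8 => //; exists x.
    by apply/subsetP => e eH; rewrite inE (subsetP sH) ?hx.
  - by right.
have card2 (H : hgraph n) : extremal2 H setT -> #|H| = second_max n.
  by move=> h; rewrite (card_extremal2 T8 h) cT.
have bound (H : hgraph n) : H \in adm Ppath (Ex_upto Ppath n 1) -> #|H| <= second_max n.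
  by move=> Ha; have [/ltnW //|/card2->] := cls H Ha.
have adm2 (H : hgraph n) : extremal2 H setT -> H \in adm Ppath (Ex_upto Ppath n 1).
  move=> h; apply/in_adm; split=> [||G /(in_Ex_upto1_8 _ n8)[x ->] sub].
  - exact: extremal2_sub T8 h.
  - exact: extremal2_pfree T8 h.
  - apply: (extremal2_nonstar (x := x) T8 h) => e /(subsetP sub).
    by rewrite inE => /andP[].
have [e ext] := maxsize_extremal bound (adm2 _ ext0) (card2 _ ext0).
split=> // H; rewrite ext; split=> [[Ha cH]|h]; last by split; [exact: adm2|exact: card2].
by have [|//] := cls H Ha; rewrite cH ltnn.
Qed.

(** * The concrete families of the statement, up to isomorphism *)

Definition initial n k : {set 'I_n} := [set x : 'I_n | x < k].

Lemma card_initial n k : k <= n -> #|initial n k| = k.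
Proof.
move=> kn; rewrite -[RHS]card_ord -cardsT.
have winj : injective (widen_ord kn) by move=> x y /(congr1 val) /= /val_inj.
rewrite -(card_imset _ winj).
apply: eq_card => x; rewrite inE; apply/idP/imsetP => [xk|[y _ ->]]; last exact: (ltn_ord y).
by exists (Ordinal xk); rewrite ?inE //; apply: val_inj.
Qed.

Lemma starE n (n0 : 0 < n) : star n = full_star (Ordinal n0) setT.
Proof.
apply/setP => e; rewrite !inE subsetT; congr (_ && _).
apply/exists_inP/idP => [[x xe /eqP x0]|oe]; last by exists (Ordinal n0).
by rewrite (_ : Ordinal n0 = x) //; apply: val_inj.
Qed.

Lemma initialE n k (e : {set 'I_n}) : [forall x in e, val x < k] = (e \subset initial n k).
Proof.
by apply/forall_inP/subsetP => h x xe; have := h x xe; rewrite inE.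
Qed.

Lemma K6_KrestE n : K6_Krest n = triples (initial n 6) :|: triples (setT :\: initial n 6).
Proof.
apply/setP => e; rewrite !inE initialE andb_orr !(andbC (#|e| == 3)); congr (_ || _ && _).
by apply/forall_inP/subsetP => h x xe; have := h x xe; rewrite !inE -leqNgt andbT.
Qed.

Lemma K6_K6E n :
  K6_K6 n = triples (initial n 6) :|: triples (initial n 12 :\: initial n 6).
Proof.
apply/setP => e; rewrite !inE initialE andb_orr !(andbC (#|e| == 3)); congr (_ || _ && _).
by apply/forall_inP/subsetP => h x xe; have := h x xe; rewrite !inE -leqNgt.
Qed.

Lemma cometE n (n0 : 0 < n) : comet n = comet_on (Ordinal n0) (initial n 4) setT.
Proof.
apply/setP => e; rewrite in_setU !in_set initialE.
have -> : [exists x in e, val x == 0] = (Ordinal n0 \in e).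
  apply/exists_inP/idP => [[x xe /eqP x0]|oe]; last by exists (Ordinal n0).
  by rewrite (_ : Ordinal n0 = x) //; apply: val_inj.
have -> : [forall x in e, (val x == 0) || (4 <= val x)] =
    (e \subset Ordinal n0 |: (setT :\: initial n 4)).
  apply/forall_inP/subsetP => h x xe; have := h x xe; rewrite !inE -leqNgt andbT.
    by case/orP=> [/eqP x0|->]; rewrite ?orbT //; apply/orP; left; apply/eqP/val_inj.
  by case/orP=> [/eqP->|->]; rewrite ?orbT.
by case: (#|e| == 3); rewrite /= ?andbF // !andbT andbC.
Qed.

Lemma isoV n (H G : hgraph n) : iso H G -> exists s : {perm 'I_n}, H = perm_image s G.
Proof. by case=> s ->; exists (s^-1)%g; rewrite -/(perm_image s H) perm_imageK. Qed.

Lemma iso_star n (n0 : 0 < n) (H : hgraph n) :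
  (exists x, H = full_star x setT) <-> iso H (star n).
Proof.
rewrite (starE n0); split=> [[x ->]|/isoV[s ->]]; last first.
  by exists (s (Ordinal n0)); rewrite perm_image_full_star imset_permT.
have c1 : #|[set x]| = #|[set Ordinal n0]| by rewrite !cards1.
have [|s [sx _]] := perm_of_two_sets c1 c1; first by rewrite !setIid.
exists s; rewrite -/(perm_image s _) perm_image_full_star imset_permT.
by move: sx; rewrite imset_set1 => /set1_inj->.
Qed.

Lemma iso_K6_Krest n (H : hgraph n) : 6 <= n ->
  (exists A : {set 'I_n}, #|A| = 6 /\ H = triples A :|: triples (setT :\: A)) <-> iso H (K6_Krest n).
Proof.
move=> n6; have c6 := card_initial n6; rewrite K6_KrestE; split=> [[A [A6 ->]]|/isoV[s ->]]; last first.
  exists (s @: initial n 6); rewrite card_imset ?c6; last exact: perm_inj.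
  by rewrite perm_imageU !perm_image_triples imset_permD imset_permT.
have c1 : #|A| = #|initial n 6| by rewrite A6 c6.
have [|s [sA _]] := perm_of_two_sets c1 c1; first by rewrite !setIid.
by exists s; rewrite -/(perm_image s _) perm_imageU !perm_image_triples imset_permD imset_permT sA.
Qed.

Lemma iso_K6_K6 n (H : hgraph n) : 12 <= n ->
  (exists A B : {set 'I_n}, [/\ [disjoint A & B], #|A| = 6 /\ #|B| = 6 & H = triples A :|: triples B]) <->
  iso H (K6_K6 n).
Proof.
move=> n12; have n6 : 6 <= n by apply: leq_trans n12.
have c6 := card_initial n6.
have c12 : #|initial n 12 :\: initial n 6| = 6.
  rewrite cardsD (setIidPr _) ?card_initial //; apply/subsetP => x; rewrite !inE => x6.
  exact: ltn_trans x6 _.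
have dis : initial n 6 :&: (initial n 12 :\: initial n 6) = set0.
  by rewrite setIDA setIC -setIDA setDv setI0.
rewrite K6_K6E; split=> [[A [B [dAB [A6 B6] ->]]]|/isoV[s ->]]; last first.
  exists (s @: initial n 6), (s @: (initial n 12 :\: initial n 6)).
  rewrite !card_imset ?c6 ?c12; try exact: perm_inj.
  rewrite perm_imageU !perm_image_triples; split=> //; rewrite -setI_eq0 -imsetI.
    by rewrite dis imset0.
  by move=> x y _ _; apply: perm_inj.
have cA : #|A| = #|initial n 6| by rewrite A6 c6.
have cB : #|B| = #|initial n 12 :\: initial n 6| by rewrite B6 c12.
have [|s [sA sB]] := perm_of_two_sets cA cB.
  by rewrite dis; move: dAB; rewrite -setI_eq0 => /eqP->.
by exists s; rewrite -/(perm_image s _) perm_imageU !perm_image_triples sA sB.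
Qed.

Lemma iso_comet n (H : hgraph n) : 4 <= n ->
  (exists d (A : {set 'I_n}), [/\ d \in A, #|A| = 4 & H = comet_on d A setT]) <-> iso H (comet n).
Proof.
move=> n4; have n0 : 0 < n by apply: leq_trans n4.
have c4 := card_initial n4; have o4 : Ordinal n0 \in initial n 4 by rewrite inE.
rewrite (cometE n0); split=> [[d [A [dA A4 ->]]]|/isoV[s ->]]; last first.
  exists (s (Ordinal n0)), (s @: initial n 4).
  rewrite imset_f // card_imset ?c4; last exact: perm_inj.
  by rewrite perm_image_comet_on imset_permT.
have c1 : #|[set d]| = #|[set Ordinal n0]| by rewrite !cards1.
have cA : #|A| = #|initial n 4| by rewrite A4 c4.
have [|s [sd sA]] := perm_of_two_sets c1 cA.
  by rewrite !(setIidPl _) ?sub1set ?cards1.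
exists s; rewrite -/(perm_image s _) perm_image_comet_on imset_permT sA.
by move: sd; rewrite imset_set1 => /set1_inj->.
Qed.

Theorem mainTheorem2 (n : nat) (hn : 7 <= n) :
  (n = 7 ->
     ex Ppath n 2 = 15 /\
     (forall H : hgraph n, H \in Ex Ppath n 2 <-> iso H (star n))) /\
  (8 <= n <= 12 ->
     ex Ppath n 2 = 20 + 'C(n - 6, 3) /\
     (forall H : hgraph n, H \in Ex Ppath n 2 <-> iso H (K6_Krest n))) /\
  (n = 13 ->
     ex Ppath n 2 = 40 /\
     (forall H : hgraph n, H \in Ex Ppath n 2 <-> iso H (K6_K6 n) \/ iso H (comet n))) /\
  (14 <= n ->
     ex Ppath n 2 = 4 + 'C(n - 4, 2) /\
     (forall H : hgraph n, H \in Ex Ppath n 2 <-> iso H (comet n))).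
Proof.
have n0 : 0 < n by apply: leq_trans hn.
have cT : #|[set: 'I_n]| = n by rewrite cardsT card_ord.
have comet0 : 13 <= n -> extremal2 (comet n) setT.
  move=> n13; constructor 4; rewrite cT; split=> //.
  have n4 : 4 <= n by apply: leq_trans n13.
  exists (Ordinal n0), (initial n 4); rewrite -cometE subsetT card_initial //.
  by split=> //; rewrite inE.
split; [|split; [|split]].
- move=> /Ex2_7[e hE]; split=> // H; exact: iff_trans (hE H) (iso_star n0 H).
- move=> n812; have /andP[n8 n12] := n812; have n6 : 6 <= n by apply: leq_trans n8.
  have ext : extremal2 (K6_Krest n) setT.
    constructor 2; rewrite cT; split=> //.
    by exists (initial n 6); rewrite subsetT card_initial // K6_KrestE.
  have [e hE] := Ex2_8 n8 ext; split.
    by rewrite e /second_max n12 leqNgt n8.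
  move=> H; apply: (iff_trans (hE H)); apply: iff_trans (iso_K6_Krest H n6).
  split=> [[[]|[_ [A [_ A6 ->]]]|[]|[]]|[A [A6 ->]]]; rewrite ?cT.
  + by move=> e7; rewrite e7 in n8.
  + by exists A.
  + by move=> e13; rewrite e13 in n12.
  + by move=> n13; rewrite leqNgt ltnS n12 in n13.
  + by constructor 2; rewrite cT; split=> //; exists A; rewrite subsetT.
- move=> e13; have n13 : 13 <= n by rewrite e13.
  have n8 : 8 <= n by apply: leq_trans n13.
  have [n12 n4] : 12 <= n /\ 4 <= n by split; apply: leq_trans n13.
  have [e hE] := Ex2_8 n8 (comet0 n13); split; first by rewrite e second_max_large // e13.
  move=> H; apply: (iff_trans (hE H)).
  have [k1 k2] := iso_K6_K6 H n12; have [c1 c2] := iso_comet H n4.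
  split=> [[[]|[]|[_ [A [B [_ _ dAB AB6 ->]]]]|[_ [d [A [dA _ A4 eH]]]]]|[/k2|/c2]]; rewrite ?cT.
  + by move=> e7; rewrite e7 in n8.
  + by case/andP=> _ n12'; rewrite e13 in n12'.
  + by left; apply/iso_K6_K6 => //; exists A, B.
  + by right; apply: c1; exists d, A.
  + by case=> A [B [dAB AB6 ->]]; constructor 3; rewrite cT; split=> //; exists A, B; rewrite !subsetT.
  + by case=> d [A [dA A4 ->]]; constructor 4; rewrite cT; split=> //; exists d, A; rewrite subsetT.
- move=> n14; have n13 : 13 <= n by apply: ltnW.
  have n8 : 8 <= n by apply: leq_trans n13.
  have n4 : 4 <= n by apply: leq_trans n13.
  have [e hE] := Ex2_8 n8 (comet0 n13); split; first by rewrite e second_max_large.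
  move=> H; apply: (iff_trans (hE H)); apply: iff_trans (iso_comet H n4).
  split=> [[[]|[]|[]|[_ [d [A [dA _ A4 ->]]]]]|[d [A [dA A4 ->]]]]; rewrite ?cT.
  + by move=> e7; rewrite e7 in n8.
  + by case/andP=> _ n12; have := leq_trans n14 n12.
  + by move=> e13; rewrite e13 in n14.
  + by exists d, A.
  + by constructor 4; rewrite cT; split=> //; exists d, A; rewrite subsetT.
Qed.
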